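(* Let $k$ be an algebraically closed field of characteristic $0$, let $d\in\mathbb{N}$, and let $f,g\in k\langle x_1,\dots,x_d\rangle$. Then the eigenlevel sets of $f$ and $g$ coincide, i.e. $L_\lambda(f)=L_\lambda(g)$ for all $\lambda\in k$, if and only if there is a nonzero $a\in k\langle x_1,\dots,x_d\rangle$ such that $fa=ag$.
   Context: $k\langle x_1,\dots,x_d\rangle$ denotes the free associative (unital) $k$-algebra in freely noncommuting variables $x_1,\dots,x_d$. For $n\in\mathbb{N}=\{1,2,\dots\}$ let $M_n(k)$ be the algebra of $n\times n$ matrices over $k$. For $X\in M_n(k)^d$, $f(X)\in M_n(k)$ denotes the evaluation of $f$ at $X$. The eigenlevel set of $f$ at $\lambda\in k$ is $$L_\lambda(f)=\bigcup_{n\in\mathbb{N}}\{X\in M_n(k)^d : \lambda \text{ is an eigenvalue of } f(X)\}.$$ *)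

(* Defs.v *)
From HB Require Import structures.
From mathcomp Require Import all_boot all_algebra.
From mathcomp.multinomials Require Export monalg.

Set Implicit Arguments.
Unset Strict Implicit.
Unset Printing Implicit Defensive.

Import GRing.Theory.
Local Open Scope ring_scope.

(* The free algebra k<x_1, ..., x_d>: the algebra over k of the free monoid of
   words in the letters 'I_d. *)
Notation free_alg k d := {malg k[{fmonom 'I_d}]}.

(* Matrix sizes are written n.+1, so that only sizes >= 1 occur. *)
Definition mx_point (k : fieldType) (d : nat) : Type :=
  {n : nat & {ffun 'I_d -> 'M[k]_n.+1}}.

Definition word_eval (k : fieldType) (d n : nat)
    (X : {ffun 'I_d -> 'M[k]_n.+1}) (w : {fmonom 'I_d}) : 'M[k]_n.+1 :=
  \prod_(i <- w) X i.

Definition nc_eval (k : fieldType) (d n : nat)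
    (X : {ffun 'I_d -> 'M[k]_n.+1}) (f : free_alg k d) : 'M[k]_n.+1 :=
  mmap (@scalar_mx k n.+1) (word_eval X) f.

(* [eigenvalue] asks for a nonzero row eigenvector; a square matrix over a field
   has the same eigenvalues for row and for column vectors. *)
Definition eigenlevel (k : fieldType) (d : nat) (lam : k) (f : free_alg k d) :
    pred (mx_point k d) :=
  fun X => eigenvalue (nc_eval (projT2 X) f) lam.

(* Main.v *)
(* If [f a = a g] with [a] nonzero, then [a] is invertible at some tuple [Y] (a
   cyclic weighted shift), so [det (f - r)] and [det (g - r)] agree at the
   generic point of a line from [X] to [Y], hence at [X].

   Conversely, work over [K = k(t)]. There [f - t] is irreducible, being of
   degree one in [t]. A polynomial [G] with [G(0) = 1] has a finite-dimensional
   module, made of the polynomials of smaller degree under the backward shifts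
   [p |-> L_i (p - p(0) G)]; for irreducible [G] every nonzero submodule
   contains [1]. Consider the modules of [f - t] and [g - t]. Either some [s]
   kills the submodule generated by [1] in the former and fixes [1] in the
   latter; then, by duality, the module of [1 - s] is a matrix tuple at which
   [g - t] is singular and [f - t] is not, and specializing [t] contradicts the
   equality of the eigenlevel sets. Or there is a nonzero homomorphism between
   them, that is, [(f - t) a = b (g - t)] over [K] with [deg a < deg g]; after
   clearing denominators, evaluating [t] on the right at [g] turns this into
   [f r = r g], and the degree bound gives [r <> 0]. *)

From HB Require Import structures.
Require Import Defs.
From mathcomp Require Import all_boot all_algebra generic_quotient.
From mathcomp Require Import zify ring.
From Stdlib Require Import Classical.

Set Implicit Arguments.
Unset Strict Implicit.
Unset Printing Implicit Defensive.

Import GRing.Theory.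
Local Open Scope ring_scope.

(** * Words and the free algebra *)

(** Why [t] is generic: a special level [f - r] may factor, and if [G = s * q] with nonconstant
    factors, the products [m * q] with [deg m < deg s] form a submodule of the module of [G] that
    misses [1]. Over [K] this cannot happen, and since [f(0) - t] is never zero there, the
    normalization [G(0) = 1] costs only a scalar. Both alternatives, separation and homomorphism,
    rest on [1] lying in every nonzero submodule. Constant [f] or [g], whose generic level is a
    unit, are treated apart. Characteristic zero provides the distinct interpolation points
    [0, ..., N] for the weights of the cyclic shift. *)

Section Words.
Variable d : nat.
Implicit Types w : seq 'I_d.

Fixpoint words n : seq (seq 'I_d) :=
  if n is m.+1 then [::] :: [seq i :: w | i <- enum 'I_d, w <- words m] else [::].

Lemma mem_words n w : (w \in words n) = (size w < n)%N.
Proof.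
elim: n w => [|n IHn] w //=; rewrite in_cons.
case: w => [|i w] //=; rewrite ltnS -IHn.
by apply/allpairsP/idP => [[[j u] /= [_ Hu [_ ->]]]|Hw] //; exists (i, w); rewrite mem_enum.
Qed.

Lemma words_uniq n : uniq (words n).
Proof.
elim: n => //= n IHn; rewrite allpairs_uniq ?enum_uniq ?andbT //.
  by apply/negP => /allpairsP[[j u] [_ _]].
by move=> [i u] [j v] _ _ /= [-> ->].
Qed.

Lemma big_words (V : nmodType) n (h : seq 'I_d -> V) :
  \sum_(w <- words n.+1) h w = h [::] + \sum_i \sum_(w <- words n) h (i :: w).
Proof. by rewrite /= big_cons big_allpairs_dep big_enum. Qed.

Lemma big_words_widen (V : nmodType) m n (h : seq 'I_d -> V) : (m <= n)%N ->
  (forall w, (m <= size w)%N -> h w = 0) ->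
  \sum_(w <- words n) h w = \sum_(w <- words m) h w.
Proof.
elim: m n h => [|m IHm] [|n] h //.
- by move=> _ h0; rewrite [RHS]big_nil big1_seq // => w _; apply: h0.
- by move=> lemn h0; rewrite !big_words; congr (_ + _); apply: eq_bigr => i _; apply: IHm => // w Hw; apply: h0.
Qed.

End Words.

(* The free algebra, presented by its words [mon] and coefficient functionals
   [cf]. Only this interface is used before the last section: it keeps the
   finitely supported maps behind [malg] away from unification. *)
Record freeAlg (F : fieldType) (d : nat) := FreeAlg {
  freeAlg_sort :> lalgType F;
  cf : freeAlg_sort -> seq 'I_d -> F;
  mon : seq 'I_d -> freeAlg_sort;
  cfD : forall p q w, cf (p + q) w = cf p w + cf q w;
  cfZ : forall c p w, cf (c *: p) w = c * cf p w;
  cf_mon : forall u w, cf (mon u) w = (u == w)%:R;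
  mon_nil : mon [::] = 1;
  monM : forall u v, mon u * mon v = mon (u ++ v);
  scaleAr : forall (c : F) (p q : freeAlg_sort), p * (c *: q) = c *: (p * q);
  cf_expand_ex : forall p,
    exists n, p == \sum_(w <- words d n) cf p w *: mon w }.

Arguments cf {F d f}.
Arguments mon {F d f}.

Section FreeAlgebra.
Variables (F : fieldType) (d : nat) (A : freeAlg F d).
Implicit Types (p q r s : A) (w u v : seq 'I_d) (c : F).

Lemma cf0 w : cf (0 : A) w = 0.
Proof. by rewrite -(scale0r (0 : A)) cfZ mul0r. Qed.
Lemma cfN p w : cf (- p) w = - cf p w.
Proof. by rewrite -scaleN1r cfZ mulN1r. Qed.
Lemma cfB p q w : cf (p - q) w = cf p w - cf q w.
Proof. by rewrite cfD cfN. Qed.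
Lemma cf_sum I (r : seq I) (P : pred I) (h : I -> A) w :
  cf (\sum_(i <- r | P i) h i) w = \sum_(i <- r | P i) cf (h i) w.
Proof. by apply: (big_morph (fun p => cf p w)) => [p q|]; rewrite ?cfD ?cf0. Qed.
Lemma cf1 w : cf (1 : A) w = ([::] == w)%:R.
Proof. by rewrite -mon_nil cf_mon. Qed.

Lemma cf_sum_words n (h : seq 'I_d -> F) w :
  cf (\sum_(u <- words d n) h u *: mon u : A) w = if (size w < n)%N then h w else 0.
Proof.
rewrite cf_sum; case: ifP => [Hw|Hw]; last first.
  rewrite big1_seq // => u /=; rewrite mem_words => Hu; rewrite cfZ cf_mon.
  by case: eqP => [E|_]; rewrite ?mulr0 //; move: Hu; rewrite E Hw.
rewrite (bigD1_seq w) ?mem_words ?words_uniq //= cfZ cf_mon eqxx mulr1 big1 ?addr0 //.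
by move=> u ne; rewrite cfZ cf_mon (negbTE ne) mulr0.
Qed.

(* One more than the degree, and [0] for the zero polynomial. *)
Definition deg p : nat := ex_minn (cf_expand_ex p).

Lemma deg_leP p n :
  reflect (forall w, (n <= size w)%N -> cf p w = 0) (deg p <= n)%N.
Proof.
rewrite /deg; case: ex_minnP => m /eqP Em Hm; apply: (iffP idP) => [le w ge|H].
  by rewrite Em cf_sum_words ltnNge (leq_trans le ge).
apply: Hm; rewrite {1}Em; apply/eqP.
have H' u : (n <= size u)%N -> cf p u *: mon u = 0 :> A by move=> /H ->; rewrite scale0r.
have H'' u : (m <= size u)%N -> cf p u *: mon u = 0 :> A.
  by move=> le; rewrite Em cf_sum_words ltnNge le scale0r.
rewrite -(big_words_widen (leq_maxl m n) H'').
by rewrite -(big_words_widen (leq_maxr m n) H').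
Qed.

Lemma cf_deg p w : (deg p <= size w)%N -> cf p w = 0.
Proof. exact: deg_leP. Qed.

Lemma cfP p q : (forall w, cf p w = cf q w) -> p = q.
Proof.
move=> H; apply/eqP; rewrite -subr_eq0; apply/eqP; set r := p - q.
have r0 w : cf r w = 0 by rewrite cfB H subrr.
by have [n /eqP ->] := cf_expand_ex r; rewrite big1 // => w _; rewrite r0 scale0r.
Qed.

Lemma deg_eq0 p : (deg p == 0%N) = (p == 0).
Proof.
apply/eqP/eqP => [E|->]; last by apply/eqP; rewrite -leqn0; apply/deg_leP => w _; apply: cf0.
by apply: cfP => w; rewrite cf0 cf_deg // E.
Qed.

Lemma deg0 : deg 0 = 0%N.
Proof. by apply/eqP; rewrite -leqn0; apply/deg_leP => w _; apply: cf0. Qed.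

Lemma deg_lead p : p != 0 -> exists2 w, (size w).+1 = deg p & cf p w != 0.
Proof.
move=> p0; apply: NNPP => H.
have : (deg p <= (deg p).-1)%N.
  apply/deg_leP => w le; apply/eqP/negP => /negP ne0; apply: H; exists w => //.
  apply/eqP; rewrite eqn_leq; apply/andP; split; last first.
    by move: le; case: (deg p).
  by rewrite ltnNge; apply/negP => /cf_deg E; rewrite E eqxx in ne0.
by move: p0; rewrite -deg_eq0; case: (deg p) => // n; rewrite ltnn.
Qed.

Lemma degD n p q : (deg p <= n -> deg q <= n -> deg (p + q)%R <= n)%N.
Proof.
by move=> /deg_leP Hp /deg_leP Hq; apply/deg_leP => w Hw; rewrite cfD Hp // Hq // addr0.
Qed.

Lemma degZ n c p : (deg p <= n -> deg (c *: p)%R <= n)%N.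
Proof. by move=> /deg_leP Hp; apply/deg_leP => w Hw; rewrite cfZ Hp // mulr0. Qed.

Lemma degB n p q : (deg p <= n -> deg q <= n -> deg (p - q)%R <= n)%N.
Proof. by move=> Hp Hq; rewrite -scaleN1r; apply: degD => //; apply: degZ. Qed.

Lemma deg_sum n I (r : seq I) (P : pred I) (h : I -> A) :
  (forall i, P i -> (deg (h i) <= n)%N) ->
  (deg (\sum_(i <- r | P i) h i)%R <= n)%N.
Proof.
by move=> H; elim/big_ind: _ => //; [rewrite deg0 | move=> x y; apply: degD].
Qed.

Lemma deg_mon w : (deg (mon w) <= (size w).+1)%N.
Proof.
apply/deg_leP => u lt; rewrite cf_mon; case: eqP => // E.
by rewrite E ltnn in lt.
Qed.

Lemma deg1 : (deg 1 <= 1)%N.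
Proof. by rewrite -mon_nil; apply: deg_mon. Qed.

Lemma deg_le1 p : (deg p <= 1)%N -> p = (cf p [::])%:A.
Proof.
move=> /deg_leP H; apply: cfP => w; rewrite cfZ cf1.
by case: w => [|i w]; rewrite ?mulr1 // H ?mulr0.
Qed.

Lemma cf_expand n p : (deg p <= n)%N -> p = \sum_(w <- words d n) cf p w *: mon w.
Proof.
by move=> /deg_leP H; apply: cfP => w; rewrite cf_sum_words; case: ltnP => // /H.
Qed.

Lemma freeAlg_ind (P : A -> Prop) :
  P 0 -> (forall p q, P p -> P q -> P (p + q)) ->
  (forall c w, P (c *: mon w)) -> forall p, P p.
Proof. by move=> P0 PD PU p; rewrite (cf_expand (leqnn (deg p))); apply: big_ind. Qed.

Section Lin.
Variables (V : lmodType F) (h : seq 'I_d -> V).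

Definition lin p : V := \sum_(w <- words d (deg p)) cf p w *: h w.

Lemma linE n p : (deg p <= n)%N -> lin p = \sum_(w <- words d n) cf p w *: h w.
Proof.
move=> le; rewrite /lin (big_words_widen le) // => w /cf_deg ->.
by rewrite scale0r.
Qed.

Lemma lin_is_linear : linear lin.
Proof.
move=> c p q; pose n := maxn (deg p) (deg q).
have Hp : (deg p <= n)%N by apply: leq_maxl.
have Hq : (deg q <= n)%N by apply: leq_maxr.
rewrite (linE Hp) (linE Hq) (@linE n); last by apply: degD; first apply: degZ.
rewrite scaler_sumr -big_split; apply: eq_bigr => w _ /=.
by rewrite cfD cfZ scalerDl scalerA.
Qed.

HB.instance Definition _ := GRing.isLinear.Build F A V *:%R lin lin_is_linear.

Lemma lin_mon w : lin (mon w) = h w.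
Proof.
rewrite (linE (deg_mon w)) (bigD1_seq w) ?mem_words ?words_uniq //=.
rewrite cf_mon eqxx scale1r big1 ?addr0 // => u ne.
by rewrite cf_mon eq_sym (negbTE ne) scale0r.
Qed.
End Lin.

(* [ld i] strips a leading letter [i]: [p = p(0) + sum_i x_i (ld i p)]. *)
Definition ld i : A -> A :=
  lin (fun w => if w is j :: u then if j == i then mon u else 0 else 0).
HB.instance Definition _ i := GRing.Linear.on (ld i).

Lemma cf_ld i p w : cf (ld i p) w = cf p (i :: w).
Proof.
elim/freeAlg_ind: p => [|p q Hp Hq|c u]; first by rewrite linear0 !cf0.
  by rewrite linearD !cfD Hp Hq.
rewrite linearZ /= /ld lin_mon !cfZ cf_mon.
case: u => [|j u]; rewrite ?cf0 //= eqseq_cons.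
by case: (j == i) => /=; rewrite ?cf0 ?cf_mon.
Qed.

Lemma cf_xmul i p w :
  cf (mon [:: i] * p) w = if w is j :: u then (i == j)%:R * cf p u else 0.
Proof.
elim/freeAlg_ind: p w => [w|p q Hp Hq w|c u w].
- by rewrite mulr0 cf0; case: w => // j w; rewrite cf0 mulr0.
- by rewrite mulrDr cfD Hp Hq; case: w => [|j w]; rewrite ?addr0 // cfD mulrDr.
rewrite scaleAr cfZ monM cf_mon /=; case: w => [|j w]; first by rewrite mulr0.
by rewrite cfZ cf_mon eqseq_cons -mulnb natrM mulrCA.
Qed.

Lemma ld_xmul i j p : ld i (mon [:: j] * p) = (j == i)%:R *: p.
Proof. by apply: cfP => w; rewrite cf_ld cf_xmul cfZ. Qed.

Lemma ld_expand p : p = (cf p [::])%:A + \sum_i mon [:: i] * ld i p.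
Proof.
apply: cfP => w; rewrite cfD cf_sum cfZ cf1.
case: w => [|j w].
  by rewrite mulr1 big1 ?addr0 // => i _; rewrite cf_xmul.
rewrite mulr0 add0r (bigD1 j) //= cf_xmul eqxx mul1r cf_ld big1 ?addr0 //.
by move=> i ne; rewrite cf_xmul (negbTE ne) mul0r.
Qed.

Lemma cfM_nil p q : cf (p * q) [::] = cf p [::] * cf q [::].
Proof.
rewrite {1}(ld_expand p) mulrDl cfD mulr_algl cfZ mulr_suml cf_sum big1 ?addr0 //.
by move=> i _; rewrite -mulrA cf_xmul.
Qed.

Lemma ldM i p q : ld i (p * q) = ld i p * q + cf p [::] *: ld i q.
Proof.
rewrite {1}(ld_expand p) mulrDl mulr_algl linearD linearZ /= addrC; congr (_ + _).
rewrite mulr_suml linear_sum (bigD1 i) //= -mulrA ld_xmul eqxx scale1r big1 ?addr0 //.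
by move=> j ne; rewrite -mulrA ld_xmul (negbTE ne) scale0r.
Qed.

Lemma ldC i c : ld i c%:A = 0.
Proof.
by apply: cfP => w; rewrite cf_ld cfZ cf1 mulr0 cf0.
Qed.

Lemma deg_ld n i p : (deg p <= n.+1 -> deg (ld i p) <= n)%N.
Proof. by move=> /deg_leP H; apply/deg_leP => w Hw; rewrite cf_ld H. Qed.

Lemma deg_xmul n i p : (deg p <= n -> deg (mon [:: i] * p) <= n.+1)%N.
Proof.
move=> /deg_leP H; apply/deg_leP => -[|j w] Hw; rewrite cf_xmul // H ?mulr0 //.
Qed.

Lemma degM_le m n p q : (deg p <= m -> deg q <= n.+1 -> deg (p * q) <= m + n)%N.
Proof.
elim: m p => [|m IHm] p Hp Hq.
  by move: Hp; rewrite leqn0 deg_eq0 => /eqP ->; rewrite mul0r deg0.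
rewrite (ld_expand p) mulrDl mulr_algl mulr_suml; apply: degD.
  by apply: degZ; apply: leq_trans Hq _; rewrite addSn ltnS leq_addl.
by apply: deg_sum => i _; rewrite -mulrA; apply: deg_xmul; apply: IHm => //; apply: deg_ld.
Qed.

(** At top degree a word can be split in one place only, so nothing cancels; this makes the degree
    additive and the free algebra a domain. *)
Lemma cfM_top p q u v : (deg p <= (size u).+1)%N -> (deg q <= (size v).+1)%N ->
  cf (p * q) (u ++ v) = cf p u * cf q v.
Proof.
elim: u p => [|i u IHu] p Hp Hq /=.
  by rewrite {1}(deg_le1 Hp) mulr_algl cfZ.
rewrite -cf_ld ldM cfD IHu ?deg_ld // cf_ld cfZ [cf (ld i q) _]cf_deg ?mulr0 ?addr0 //.
by rewrite size_cat; apply: leq_trans (leq_addl _ _); apply: deg_ld.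
Qed.

Lemma degM p q : p != 0 -> q != 0 -> deg (p * q) = (deg p + deg q).-1.
Proof.
move=> /deg_lead[u Hu p0] /deg_lead[v Hv q0]; apply/eqP; rewrite eqn_leq; apply/andP; split.
  by rewrite -Hv addnS /=; apply: degM_le; rewrite ?Hv.
rewrite -Hu -Hv addnS /= addSn ltnNge; apply/negP => H.
have := @cf_deg (p * q) (u ++ v); rewrite size_cat => /(_ H).
by rewrite cfM_top ?Hu ?Hv // => /eqP; rewrite mulf_eq0 (negbTE p0) (negbTE q0).
Qed.

Lemma freeAlg_mulf_eq0 p q : p * q = 0 -> p = 0 \/ q = 0.
Proof.
case: (eqVneq p 0) => [|p0]; first by left.
case: (eqVneq q 0) => [|q0 H]; first by right.
have := degM p0 q0; rewrite H deg0; move: p0 q0; rewrite -!deg_eq0.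
by case: (deg p) (deg q) => // a [|b] //; rewrite addnS.
Qed.

End FreeAlgebra.

(** * Modules of polynomials *)

Section RestartingShift.
Variables (F : fieldType) (d : nat) (A : freeAlg F d).
Implicit Types (G H p q r s : A) (w u v : seq 'I_d) (c : F).

(* Backward shift that restarts along [G]. The polynomials of degree less than
   that of [G] form a module over the free algebra, letters acting by [rs G] on
   the right; it stands for the left module of [G], since
   [p = p(0) G + sum_i x_i (rs G i p)]. *)
Definition rs G i p : A := ld i (p - cf p [::] *: G).

Lemma rs_is_linear G i : linear (rs G i).
Proof.
move=> c p q; rewrite /rs -linearP; congr (ld i _).
by rewrite cfD cfZ scalerBr scalerDl scalerA opprD addrACA.
Qed.
HB.instance Definition _ G i := GRing.isLinear.Build F A A *:%R (rs G i) (rs_is_linear G i).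

Lemma rsE G i p : rs G i p = ld i p - cf p [::] *: ld i G.
Proof. by rewrite /rs linearB linearZ. Qed.

Lemma rs1 G i : rs G i 1 = - ld i G.
Proof. by rewrite rsE cf1 eqxx scale1r -[1](scale1r) ldC sub0r. Qed.

Lemma rs_expand G p : cf G [::] = 1 ->
  p - cf p [::] *: G = \sum_i mon [:: i] * rs G i p.
Proof.
move=> G1; rewrite [LHS]ld_expand cfB cfZ G1 mulr1 subrr scale0r add0r.
by apply: eq_bigr.
Qed.

Lemma deg_rs n G i p : (deg G <= n.+1 -> deg p <= n.+1 -> deg (rs G i p) <= n)%N.
Proof. by move=> HG Hp; apply: deg_ld; apply: degB => //; apply: degZ. Qed.

Definition rsw G w p : A := foldl (fun p i => rs G i p) p w.

Lemma rsw_is_linear G w : linear (rsw G w).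
Proof.
by move=> c p q; elim: w p q => //= i w IHw p q; rewrite linearP IHw.
Qed.
HB.instance Definition _ G w := GRing.isLinear.Build F A A *:%R (rsw G w) (rsw_is_linear G w).

(** The right action [p . s], defined on all of [A] rather than on a subtype of bounded degree;
    [stable_deg] recovers the finite-dimensional module. *)
Definition act G p : A -> A := lin (fun w => rsw G w p).
HB.instance Definition _ G p := GRing.Linear.on (act G p).

Lemma act_mon G p w : act G p (mon w) = rsw G w p.
Proof. exact: lin_mon. Qed.

Lemma act1 G p : act G p 1 = p.
Proof. by rewrite -mon_nil act_mon. Qed.

Lemma act0s G p : act G p 0 = 0. Proof. exact: linear0. Qed.
Lemma actDs G p s r : act G p (s + r) = act G p s + act G p r.
Proof. exact: linearD. Qed.
Lemma actZs G p c s : act G p (c *: s) = c *: act G p s.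
Proof. exact: linearZ. Qed.

Lemma act_is_linear G s : linear (fun p => act G p s).
Proof.
move=> c p q; elim/freeAlg_ind: s => [|s r Hs Hr|b w].
- by rewrite !act0s scaler0 addr0.
- by rewrite !actDs Hs Hr scalerDr addrACA.
- by rewrite !actZs !act_mon linearP scalerDr !scalerA mulrC.
Qed.
Definition actr G s p : A := act G p s.
HB.instance Definition _ G s := GRing.isLinear.Build F A A *:%R (actr G s) (act_is_linear G s).

Lemma act0p G s : act G 0 s = 0. Proof. exact: (linear0 (actr G s)). Qed.
Lemma actDp G p q s : act G (p + q) s = act G p s + act G q s.
Proof. exact: (linearD (actr G s)). Qed.
Lemma actNp G p s : act G (- p) s = - act G p s.
Proof. exact: (linearN (actr G s)). Qed.
Lemma actZp G c p s : act G (c *: p) s = c *: act G p s.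
Proof. exact: (linearZZ (actr G s)). Qed.
Lemma act_sum_p G s I (r : seq I) (P : pred I) (h : I -> A) :
  act G (\sum_(i <- r | P i) h i) s = \sum_(i <- r | P i) act G (h i) s.
Proof. exact: (linear_sum (actr G s)). Qed.
Lemma act_sum_s G p I (r : seq I) (P : pred I) (h : I -> A) :
  act G p (\sum_(i <- r | P i) h i) = \sum_(i <- r | P i) act G p (h i).
Proof. exact: linear_sum. Qed.
Lemma actBs G p s r : act G p (s - r) = act G p s - act G p r.
Proof. exact: linearB. Qed.

Lemma actM G p s r : act G p (s * r) = act G (act G p s) r.
Proof.
elim/freeAlg_ind: s => [|s s' Hs Hr|b w].
- by rewrite mul0r !act0s act0p.
- by rewrite mulrDl !actDs Hs Hr actDp.
rewrite -scalerAl !actZs actZp; congr (_ *: _).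
elim/freeAlg_ind: r => [|r r' Hs Hr|c u].
- by rewrite mulr0 !act0s.
- by rewrite mulrDr !actDs Hs Hr.
rewrite scaleAr !actZs monM !act_mon.
by rewrite /rsw foldl_cat.
Qed.

Lemma act_x G p i : act G p (mon [:: i]) = rs G i p.
Proof. by rewrite act_mon. Qed.

Definition subspace (S : A -> Prop) : Prop :=
  S 0 /\ forall c p q, S p -> S q -> S (c *: p + q).

Lemma subspaceZ S c p : subspace S -> S p -> S (c *: p).
Proof. by move=> [S0 SD] Sp; rewrite -[_ *: _]addr0; apply: SD. Qed.

Lemma subspaceD S p q : subspace S -> S p -> S q -> S (p + q).
Proof. by move=> [S0 SD] Sp Sq; rewrite -[p]scale1r; apply: SD. Qed.

Lemma subspaceB S p q : subspace S -> S p -> S q -> S (p - q).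
Proof. by move=> [S0 SD] Sp Sq; rewrite addrC -scaleN1r; apply: SD. Qed.

Lemma subspace_sum S I (r : seq I) (P : pred I) (h : I -> A) : subspace S ->
  (forall i, P i -> S (h i)) -> S (\sum_(i <- r | P i) h i).
Proof.
by move=> HS H; elim/big_ind: _ => //; [case: HS | move=> x y; apply: subspaceD].
Qed.

Definition stable G (S : A -> Prop) : Prop :=
  subspace S /\ forall i p, S p -> S (rs G i p).

Lemma stable_act G S p s : stable G S -> S p -> S (act G p s).
Proof.
move=> [HS ST]; elim/freeAlg_ind: s => [|s r Hs Hr|b w] Sp.
- by rewrite act0s; case: HS.
- by rewrite actDs; apply: subspaceD => //; auto.
rewrite actZs act_mon; apply: subspaceZ => //.
by elim: w p Sp => //= i w IHw p Sp; apply: IHw; apply: ST.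
Qed.

Lemma stable_deg G n : (deg G <= n.+1)%N -> stable G (fun p => (deg p <= n)%N).
Proof.
move=> HG; split; first split; first by rewrite deg0.
  by move=> c p q Hp Hq; apply: degD => //; apply: degZ.
by move=> i p Hp; apply: deg_rs => //; apply: leqW.
Qed.

Lemma deg_act1 G s : (1 < deg G)%N -> (deg (act G 1 s) < deg G)%N.
Proof.
case E : (deg G) => [|n] // n1; rewrite ltnS.
have HS := @stable_deg G n; rewrite E in HS.
by apply: (stable_act s (HS (leqnn _))); apply: leq_trans (deg1 _) _.
Qed.

(** Under the contraction [q (x) p |-> act H q p], the operator [sum_i rs H i (x) rs G i] becomes
    [p |-> p - p(0) G]. This drives the duality below. *)
Lemma act_expand G H p q : cf G [::] = 1 ->
  act H q (p - cf p [::] *: G) = \sum_i act H (rs H i q) (rs G i p).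
Proof.
move=> G1; rewrite rs_expand // act_sum_s; apply: eq_bigr => i _.
by rewrite actM act_x.
Qed.

End RestartingShift.

(* The modules of [G] and [H] are in duality: [H] kills a vector of the module
   of [G] exactly when [G] kills a vector of the module of [H]. Both amount to a
   nonzero tensor invariant under [sum_i rs G i (x) rs H i]; below it is
   [sum_w dual_coef w (x) w], and [dual_vec] is its contraction by the constant
   term of the first factor. *)
Section Duality.
Variables (F : fieldType) (d : nat) (A : freeAlg F d) (G H v : A).
Implicit Types (p q r s : A) (w u : seq 'I_d) (c : F).
Hypotheses (G1 : cf G [::] = 1) (H1 : cf H [::] = 1) (v0 : v != 0) (vH : act G v H = 0).

Local Definition right_quot w : A := \sum_(u <- words d (deg H)) cf H (u ++ w) *: mon u.

Let cf_right_quot w u : cf (right_quot w) u = cf H (u ++ w).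
Proof.
rewrite cf_sum_words; case: ltnP => // le; rewrite cf_deg // size_cat.
exact: leq_trans le (leq_addr _ _).
Qed.

Let cf_mulx p i w : cf (p * mon [:: i]) w =
  if w is j :: u then (last j u == i)%:R * cf p (belast j u) else 0.
Proof.
case: w => [|j w]; first by rewrite cfM_nil cf_mon mulr0.
elim/freeAlg_ind: p => [|p q Hp Hq|c u].
- by rewrite mul0r !cf0 mulr0.
- by rewrite mulrDl !cfD Hp Hq mulrDr.
rewrite -scalerAl !cfZ monM !cf_mon mulrCA; congr (_ * _).
by rewrite (lastI j w) cats1 eqseq_rcons -mulnb natrM mulrC [_ == i]eq_sym.
Qed.

Let right_quot_rec w : right_quot w = cf H w *: 1 + \sum_i right_quot (i :: w) * mon [:: i].
Proof.
apply: cfP => u; rewrite cf_right_quot cfD cfZ cf1 cf_sum.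
case: u => [|j u]; first by rewrite mulr1 big1 ?addr0 // => i _; rewrite cf_mulx.
rewrite mulr0 add0r (bigD1 (last j u)) //= cf_mulx eqxx mul1r cf_right_quot big1 ?addr0 => [|i ne].
  by rewrite -cat_rcons -lastI.
by rewrite cf_mulx eq_sym (negbTE ne) mul0r.
Qed.

(** Minus the action on [v] of the part of [right_quot w] without constant term. The kernel equation
    [vH] makes the entry at the empty word equal to [v]. *)
Local Definition dual_coef w : A := cf H w *: v - act G v (right_quot w).

Let dual_coef_nil : dual_coef [::] = v.
Proof.
have -> : dual_coef [::] = v - act G v H.
  rewrite /dual_coef H1 scale1r; congr (_ - act _ _ _); apply: cfP => u.
  by rewrite cf_right_quot cats0.
by rewrite vH subr0.
Qed.

Let dual_coef_rec w : dual_coef w = \sum_i rs G i (dual_coef (i :: w) - cf H (i :: w) *: v).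
Proof.
rewrite {1}/dual_coef right_quot_rec actDs actZs act1 opprD addrA subrr sub0r act_sum_s -sumrN.
apply: eq_bigr => i _; rewrite actM act_x -linearN; congr (rs G i _).
by rewrite /dual_coef addrAC subrr sub0r.
Qed.

Local Notation n := (deg H).-1.

Let dual_coef_big w : (n <= size w)%N -> dual_coef w = 0.
Proof.
move=> le; rewrite /dual_coef right_quot_rec big1 ?addr0 ?actZs ?act1 ?subrr // => i _.
suff -> : right_quot (i :: w) = 0 by rewrite mul0r.
apply: cfP => u; rewrite cf_right_quot cf0 cf_deg // size_cat /= addnS.
apply: leq_trans (_ : (size w).+1 <= _)%N; last by rewrite ltnS leq_addl.
by move: le; case: (deg H).
Qed.

Local Definition dual_vec : A := \sum_(w <- words d n) cf (dual_coef w) [::] *: mon w.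

Let n_gt0 : (0 < n)%N.
Proof.
rewrite lt0n; apply/negP => /eqP n0; move: v0; rewrite -dual_coef_nil.
by rewrite dual_coef_big ?eqxx // n0.
Qed.

(** If all constant terms vanished, [rs G] would be a plain backward shift on these entries, so
    [dual_coef_rec] would lower their common degree bound at each use, forcing [v = 0]. *)
Let dual_vec_neq0 : dual_vec != 0.
Proof.
apply/eqP => q0.
have Z0 w : cf (dual_coef w) [::] = 0.
  case: (ltnP (size w) n) => [lt|le]; last by rewrite dual_coef_big ?cf0.
  by move: (cf_sum_words A n (fun w => cf (dual_coef w) [::]) w); rewrite -/dual_vec q0 cf0 lt.
have Zdeg m : forall w, (deg (dual_coef w) <= maxn (deg v) (deg G) - m)%N.
  elim: m => [|m IHm] w.
    rewrite subn0; have Hv := leq_maxl (deg v) (deg G).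
    apply: degB; first exact: degZ.
    exact: (stable_act _ (stable_deg (leqW (leq_maxr (deg v) (deg G))))).
  rewrite dual_coef_rec; apply: deg_sum => i _.
  have c0 : cf (dual_coef (i :: w) - cf H (i :: w) *: v) [::] = 0.
    by rewrite cfB cfZ -dual_coef_nil !Z0 mulr0 subr0.
  rewrite rsE c0 scale0r subr0.
  have := IHm (i :: w); have := IHm [::]; rewrite dual_coef_nil subnS.
  case: (_ - m)%N => [|m']; last by move=> *; apply: deg_ld; apply: degB => //; apply: degZ.
  rewrite !leqn0 !deg_eq0 => /eqP -> /eqP ->.
  by rewrite scaler0 subr0 linear0.
by have := Zdeg (maxn (deg v) (deg G)) [::]; rewrite subnn leqn0 deg_eq0 dual_coef_nil (negbTE v0).
Qed.

(** One contraction is computed twice: [act_expand] gives [beta] minus the wanted term, and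
    invariance of the tensor gives [beta]. *)
Let act_dual_vec : act H dual_vec G = 0.
Proof.
pose beta := \sum_(w <- words d n) act H (mon w) (dual_coef w).
have E1 : \sum_i \sum_(w <- words d n) act H (rs H i (mon w)) (rs G i (dual_coef w)) = beta - act H dual_vec G.
  rewrite exchange_big /= act_sum_p -sumrB.
  apply: eq_bigr => w _; by rewrite -act_expand // actBs actZs actZp.
suff E2 : \sum_i \sum_(w <- words d n) act H (rs H i (mon w)) (rs G i (dual_coef w)) = beta.
  by move: E1; rewrite E2 => /eqP; rewrite -subr_eq0 opprB addrC subrK => /eqP.
have Hrs i w : rs H i (mon w) = if w is j :: u then (j == i)%:R *: mon u else
   - \sum_(u <- words d n) cf H (i :: u) *: mon u.
  case: w => [|j u].
    rewrite mon_nil rs1; congr (- _); rewrite (@cf_expand _ _ _ n (ld i H)).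
      by apply: eq_bigr => u _; rewrite cf_ld.
    by apply: deg_ld; case: (deg H).
  by rewrite rsE cf_mon scale0r subr0 -[j :: u]cat1s -monM ld_xmul.
(* By [Hrs], only words beginning with [i] survive, shortened by that letter. The empty word yields
   [- ld i H], whose coefficients supply the corrections [cf H (i :: w)] of [dual_coef_rec]. *)
transitivity (\sum_i \sum_(w <- words d n) act H (mon w) (rs G i (dual_coef (i :: w) - cf H (i :: w) *: v))).
  apply: eq_bigr => i _; case: n n_gt0 Hrs dual_coef_big => // m _ Hrs Zb.
  rewrite big_words Hrs dual_coef_nil.
  have -> : \sum_j \sum_(w <- words d m) act H (rs H i (mon (j :: w))) (rs G i (dual_coef (j :: w)))
     = \sum_(w <- words d m.+1) act H (mon w) (rs G i (dual_coef (i :: w))).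
    rewrite (bigD1 i) //= [X in _ + X]big1 => [|j ne]; last first.
      rewrite big1 // => w _; rewrite Hrs (negbTE ne) scale0r.
      by rewrite act0p.
    rewrite addr0 -[_ :: _]/(words d m.+1) (big_words_widen (leqnSn m)) => [|w Hw].
      by apply: eq_bigr => w _; rewrite Hrs eqxx scale1r.
    by rewrite Zb // linear0 act0s.
  rewrite actNp act_sum_p -sumrN -big_split /=.
  apply: eq_bigr => w _; by rewrite addrC [in RHS]linearB [in RHS]linearZ /= actBs actZs actZp.
rewrite exchange_big; apply: eq_bigr => w _ /=.
by rewrite [in RHS]dual_coef_rec act_sum_s.
Qed.

Lemma act_duality : exists q : A, [/\ q != 0, (deg q < deg H)%N & act H q G = 0].
Proof.
exists dual_vec; split=> //; apply: leq_ltn_trans (_ : n < _)%N; last first.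
  by move: n_gt0; case: (deg H).
by apply/deg_leP => w le; rewrite cf_sum_words ltnNge le.
Qed.

End Duality.

(** * Homomorphisms as relations in the algebra; reaching [1] from long words *)

Section HomRelation.
Variables (F : fieldType) (d : nat) (A : freeAlg F d).
Implicit Types (G H p q r s a b : A) (w u v : seq 'I_d) (c : F).

Lemma ld_expandB p : p - (cf p [::])%:A = \sum_i mon [:: i] * ld i p.
Proof. by rewrite {1}(ld_expand p) addrAC subrr add0r. Qed.

(* The hypothesis says that [1 |-> a] extends to a homomorphism from the
   submodule generated by [1] in the module of [Gf] to the module of [Gg]. *)
Lemma hom_relation Gf Gg a : cf Gf [::] = 1 -> cf Gg [::] = 1 ->
  (forall r, act Gf 1 r = 0 -> act Gg a r = 0) -> exists b, Gf * a = b * Gg.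
Proof.
move=> f1 g1 Ha.
(* Induction on the degree of [q]: passing to [ld i q] and [r * x_i + q(0) x_i] preserves the
   relation, because the two multiples of [ld i Gf] cancel. At [q = 0], [r] kills [1] and [Ha]
   applies. *)
have key n : forall q r, (deg q <= n)%N -> act Gf 1 r = - q ->
    exists b, q * a + act Gg a r = b * Gg.
  elim: n => [|n IHn] q r Hq Hr.
    move: Hq Hr; rewrite leqn0 deg_eq0 => /eqP -> Hr; exists 0.
    by rewrite !mul0r add0r Ha // Hr oppr0.
  have Hi i : exists b, ld i q * a + act Gg a (r * mon [:: i] + cf q [::] *: mon [:: i]) = b * Gg.
    apply: IHn; first exact: deg_ld.
    rewrite actDs actM Hr actZs !act_x linearN /= rsE rs1 opprB scalerN addrAC subrr.
    by rewrite sub0r.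
  have [b Hb] := fin_all_exists Hi; set y := act Gg a r.
  exists (\sum_i mon [:: i] * b i + cf y [::] *: 1 + cf q [::] *: (cf a [::] *: 1)).
  rewrite scalerA !mulrDl !mulr_algl.
  have -> : (\sum_i mon [:: i] * b i) * Gg = (q - cf q [::] *: 1) * a + (y - cf y [::] *: Gg)
     + cf q [::] *: (a - cf a [::] *: Gg).
    rewrite ld_expandB !rs_expand // !mulr_suml scaler_sumr -!big_split /=.
    apply: eq_bigr => i _; rewrite -mulrA -Hb actDs actM actZs !act_x !mulrDr mulrA addrA.
    by rewrite scaleAr.
  rewrite mulrBl mulr_algl scalerBr scalerA.
  set t1 := _ *: a; set t2 := _ *: Gg; set t3 := _ *: Gg.
  by rewrite !addrA [_ - t3 + _]addrAC subrK [_ + t1 + _]addrAC subrK addrAC subrK.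
have Hi i : exists b, ld i Gf * a + act Gg a (mon [:: i]) = b * Gg.
  by apply: (key _ _ _ (leqnn _)); rewrite act_x rs1.
have [b Hb] := fin_all_exists Hi.
exists (\sum_i mon [:: i] * b i + cf a [::] *: 1).
rewrite mulrDl mulr_algl.
have -> : (\sum_i mon [:: i] * b i) * Gg = (Gf - 1) * a + (a - cf a [::] *: Gg).
  rewrite -{1}[1]scale1r -{1}f1 ld_expandB rs_expand // !mulr_suml -!big_split /=.
  by apply: eq_bigr => i _; rewrite -mulrA -Hb act_x mulrDr mulrA.
by rewrite mulrBl mul1r !addrA subrK subrK.
Qed.

Fixpoint ldw w p : A := if w is i :: u then ldw u (ld i p) else p.

Lemma cf_ldw w p u : cf (ldw w p) u = cf p (w ++ u).
Proof. by elim: w p => //= i w IHw p; rewrite IHw cf_ld. Qed.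

Lemma ldwD w p q : ldw w (p + q) = ldw w p + ldw w q.
Proof. by elim: w p q => //= i w IHw p q; rewrite linearD IHw. Qed.

Lemma ldwZ w c p : ldw w (c *: p) = c *: ldw w p.
Proof. by elim: w p => //= i w IHw p; rewrite linearZ IHw. Qed.

Lemma deg_ldw n w p : (deg p <= n + size w)%N -> (deg (ldw w p) <= n)%N.
Proof.
by move=> /deg_leP H; apply/deg_leP => u Hu; rewrite cf_ldw H // size_cat addnC leq_add2l.
Qed.

(** Every [ldw w G] with [w] nonempty is reached from [1] by a polynomial without constant term, and
    for a longest word [w] of [G] it is a nonzero constant. *)
Lemma augmentation_generates G : (1 < deg G)%N -> cf G [::] = 1 ->
  exists2 r, cf r [::] = 0 & act G 1 r = 1.
Proof.
move=> dG G1.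
have key w : w != [::] -> exists2 r, cf r [::] = 0 & act G 1 r = ldw w G.
  elim/last_ind: w => // w i IHw _; case: (eqVneq w [::]) => [->|/IHw [r r0 Hr]].
    by exists (- mon [:: i]); rewrite ?linearN /= ?act_x ?rs1 ?opprK // cfN cf_mon oppr0.
  exists (r * mon [:: i] - cf G w *: mon [:: i]).
    by rewrite cfB cfM_nil cfZ !cf_mon !mulr0 subr0.
  rewrite actBs actZs actM Hr !act_x rs1 rsE cf_ldw cats0 scalerN opprK subrK.
  by apply: cfP => u; rewrite cf_ld !cf_ldw cat_rcons.
have G0 : G != 0 by rewrite -deg_eq0 -lt0n ltnW.
have [w Hw w0] := deg_lead G0.
have [r r0 Hr] : exists2 r, cf r [::] = 0 & act G 1 r = ldw w G.
  by apply: key; apply/eqP => E; move: dG; rewrite -Hw E.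
exists ((cf G w)^-1 *: r); first by rewrite cfZ r0 mulr0.
rewrite actZs Hr (@deg_le1 _ _ _ (ldw w G)); last by apply: deg_ldw; rewrite -Hw.
by rewrite cf_ldw cats0 scalerA mulVf // scale1r.
Qed.

(** Gaussian elimination, one coordinate at a time. As [S] is a mere predicate, the existence of a
    pivot at [w] is decided classically. *)
Lemma subspace_basis (ws : seq (seq 'I_d)) (S : A -> Prop) : subspace S ->
  (forall p, S p -> {in ws, forall w, cf p w = 0} -> p = 0) ->
  exists2 b : seq A, {in b, forall x, S x} &
    forall p, S p -> exists c : 'I_(size b) -> F, p = \sum_j c j *: b`_j.
Proof.
elim: ws S => [|w ws IHws] S HS Hws.
  by exists [::] => // p Sp; exists (fun=> 0); rewrite big_ord0; apply: Hws.
have [HS0 HSD] := HS.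
case: (IHws (fun p => S p /\ cf p w = 0)).
- split; first by rewrite cf0.
  move=> c p q [Sp p0] [Sq q0]; split; first exact: HSD.
  by rewrite cfD cfZ p0 q0 mulr0 addr0.
- move=> p [Sp p0] H; apply: Hws => // u; rewrite in_cons => /orP[/eqP ->|] //; exact: H.
move=> b Hb Hspan; case: (classic (exists2 p, S p & cf p w != 0)) => [[x Sx x0]|no].
  exists (x :: b).
    by move=> y; rewrite in_cons => /orP[/eqP -> //|/Hb[]].
  move=> p Sp; have [|c Hc] := Hspan (p - (cf p w / cf x w) *: x).
    split; first by apply: subspaceB => //; apply: subspaceZ.
    by rewrite cfB cfZ divfK // subrr.
  exists (fun j => if unlift ord0 j is Some i then c i else cf p w / cf x w).
  rewrite big_ord_recl unlift_none /=.
  under eq_bigr => i _ do rewrite liftK.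
  by rewrite -Hc addrC subrK.
exists b; first by move=> y /Hb[].
move=> p Sp; apply: Hspan; split=> //; apply: NNPP => p0; apply: no; exists p => //.
exact/eqP.
Qed.

Lemma subspace_deg_basis n (S : A -> Prop) : subspace S ->
  (forall p, S p -> (deg p <= n)%N) ->
  exists2 b : seq A, {in b, forall x, S x} &
    forall p, S p -> exists c : 'I_(size b) -> F, p = \sum_j c j *: b`_j.
Proof.
move=> HS Hn; apply: (subspace_basis (ws := words d n)) => // p /Hn Hp H.
by rewrite (cf_expand Hp) big1_seq // => w /= Hw; rewrite H ?scale0r.
Qed.

(* [fil S n]: sums of products [w * p] with [p] in [S] and [w] a word of length at most [n] *)
Fixpoint fil (S : A -> Prop) n p : Prop :=
  if n is m.+1 then exists q (t : 'I_d -> A),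
    [/\ S q, forall i, fil S m (t i) & p = q + \sum_i mon [:: i] * t i]
  else S p.

Lemma fil_subspace S n : subspace S -> subspace (fil S n).
Proof.
move=> HS; elim: n => //= n [IH0 IHD]; split.
  exists 0, (fun=> 0); split=> //; first by case: HS.
  by rewrite add0r big1 // => i _; rewrite mulr0.
move=> c p q [p1 [t [Sp Ht ->]]] [q1 [t' [Sq Ht' ->]]].
exists (c *: p1 + q1), (fun i => c *: t i + t' i); split; first by case: HS => _; apply.
  by move=> i; apply: IHD.
rewrite scalerDr addrACA; congr (_ + _); rewrite scaler_sumr -big_split.
by apply: eq_bigr => i _; rewrite /= mulrDr scaleAr.
Qed.

Lemma fil_mono S n p : subspace S -> fil S n p -> fil S n.+1 p.
Proof.
move=> HS; elim: n p => [|n IHn] p.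
  move=> Sp; exists p, (fun=> 0); split=> //; first by case: HS.
  by rewrite big1 ?addr0 // => i _; rewrite mulr0.
by move=> [q [t [Sq Ht ->]]]; exists q, t; split=> // i; apply: IHn; apply: Ht.
Qed.

Lemma fil_leq S m n p : subspace S -> (m <= n)%N -> fil S m p -> fil S n p.
Proof.
by move=> HS /subnK <-; elim: (n - m)%N => //= k IHk H; apply: fil_mono => //; apply: IHk.
Qed.

(** The products [x_j * t j] have no constant term, so on them [rs G i] only strips a letter; on [S]
    itself stability suffices. *)
Lemma fil_rs G S n i p : stable G S -> fil S n.+1 p -> fil S n (rs G i p).
Proof.
move=> [HS ST] [q [t [Sq Ht ->]]]; rewrite linearD /=.
apply: subspaceD; first exact: fil_subspace.
  by apply: (fil_leq HS (leq0n n)); apply: ST.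
rewrite rsE; have -> : cf (\sum_j mon [:: j] * t j) [::] = 0.
  by rewrite cf_sum big1 // => j _; rewrite cf_xmul.
rewrite scale0r subr0 linear_sum (bigD1 i) //= ld_xmul eqxx scale1r big1 ?addr0 => [|j ne]; first exact: Ht.
by rewrite ld_xmul (negbTE ne) scale0r.
Qed.

Lemma fil_rsw G S n p w : stable G S -> fil S n p -> size w = n -> S (rsw G w p).
Proof.
move=> HS; elim: n p w => [|n IHn] p [|i w] //= Hp [Hw].
by apply: IHn => //; apply: fil_rs.
Qed.

Lemma fil_mul S s p : subspace S -> S p -> exists n, fil S n (s * p).
Proof.
move=> HS Sp; elim/freeAlg_ind: s => [|s r [m Hm] [n Hn]|c w].
- by exists 0%N; rewrite mul0r; case: HS.
- exists (maxn m n); rewrite mulrDl; apply: subspaceD; first exact: fil_subspace.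
    by apply: fil_leq Hm => //; apply: leq_maxl.
  by apply: fil_leq Hn => //; apply: leq_maxr.
rewrite -scalerAl; exists (size w); apply: subspaceZ; first exact: fil_subspace.
elim: w => [|i w IHw] /=; first by rewrite mon_nil mul1r.
exists 0, (fun j => if j == i then mon w * p else 0); split; first by case: HS.
  by move=> j; case: ifP => // _; case: (fil_subspace (size w) HS).
rewrite add0r (bigD1 i) //= eqxx mulrA monM big1 ?addr0 // => j ne.
by rewrite (negbTE ne) mulr0.
Qed.

(* [1 = 1 . r] with [r] without constant term, so [1] is reached from words of
   arbitrary length. *)
Lemma one_of_deep_words G S n : (1 < deg G)%N -> cf G [::] = 1 -> stable G S ->
  (forall w, size w = n -> S (rsw G w 1)) -> S 1.
Proof.
move=> dG G1 HS; have [r r0 Hr] := augmentation_generates dG G1.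
have [HS' _] := HS; have [S0 _] := HS'.
elim: n => [|n IHn] Hn; first exact: (Hn [::]).
apply: IHn => w Hw.
have -> : rsw G w 1 = act G 1 (r * mon w) by rewrite actM Hr act_mon.
rewrite {1}(ld_expand r) r0 scale0r add0r mulr_suml act_sum_s.
apply: subspace_sum => // i _.
elim/freeAlg_ind: (ld i r) => [|s s' IHs IHs'|c u].
- by rewrite mulr0 mul0r act0s.
- by rewrite mulrDr mulrDl actDs; apply: subspaceD.
rewrite scaleAr -scalerAl actZs !monM; apply: subspaceZ => //.
have := cat_take_drop n.+1 ([:: i] ++ u ++ w); rewrite catA => <-.
rewrite -monM actM; apply: (stable_act _ HS); rewrite act_mon; apply: Hn.
by rewrite size_takel // !size_cat /= Hw ltnS leq_addl.
Qed.

End HomRelation.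

(** * Weak algorithm *)

Section WeakAlgorithm.
Variables (F : fieldType) (d : nat) (A : freeAlg F d).
Implicit Types (G H p q r s a b : A) (w u v : seq 'I_d) (c : F).

Definition aug p : F := cf p [::].
Lemma aug_is_zmod_morphism : zmod_morphism aug.
Proof. by move=> p q; rewrite /aug cfB. Qed.
HB.instance Definition _ := GRing.isZmodMorphism.Build A F aug aug_is_zmod_morphism.
Lemma aug_is_monoid_morphism : monoid_morphism aug.
Proof. by split=> [|p q]; rewrite /aug ?cf1 ?cfM_nil. Qed.
HB.instance Definition _ := GRing.isMonoidMorphism.Build A F aug aug_is_monoid_morphism.

Definition atomic G : Prop := forall s q, G = s * q -> (deg s <= 1)%N \/ (deg q <= 1)%N.

Lemma ldw0 u : ldw u (0 : A) = 0.
Proof. by apply: cfP => w; rewrite cf_ldw !cf0. Qed.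

Lemma ldw_sum u I (r : seq I) (h : I -> A) :
  ldw u (\sum_(i <- r) h i) = \sum_(i <- r) ldw u (h i).
Proof. by apply: (big_morph (ldw u)) => [p q|]; rewrite ?ldwD ?ldw0. Qed.

(** The difference collects the terms in which [u] eats into [p], and these have lost at least one
    letter of [p]. *)
Lemma deg_ldwM u a p :
  (deg (ldw u (a * p) - ldw u a * p)%R <= (deg p).-1)%N.
Proof.
elim: u a => [|i u IHu] a /=; first by rewrite subrr deg0.
rewrite ldM ldwD ldwZ addrAC; apply: degD; first exact: IHu.
apply: degZ; apply: deg_ldw; apply: leq_trans (leq_addr _ _).
by apply: deg_ld; case: (deg p).
Qed.

(* Compare top degrees in [a *m p = 0]: stripping the leading word of the entry
   of [a] of least degree among those that reach the top degree leaves a unit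
   in front of the matching entry of [p]. *)
Lemma reduce_dependent m (a : 'rV[A]_m) (p : 'cV[A]_m) :
  a *m p = 0 -> (exists j, (a 0 j != 0) && (p j 0 != 0)) ->
  exists j0 (b : 'rV[A]_m),
    b 0 j0 = 0 /\ (deg (p j0 0 + (b *m p) 0 0)%R < deg (p j0 0%R))%N.
Proof.
move=> ap0 [j Pj]; pose P j := (a 0 j != 0) && (p j 0 != 0).
pose sum j := (deg (a 0%R j) + deg (p j 0%R))%N.
case: (@arg_maxnP _ j P sum Pj) => j1 Pj1 max1 {j Pj}.
pose Q j := P j && (sum j == sum j1).
have Qj1 : Q j1 by rewrite /Q Pj1 eqxx.
case: (@arg_minnP _ j1 Q (fun j => deg (a 0 j)) Qj1) => j0 /andP[/andP[a0 p0] /eqP sum0] min0.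
have [u Hu cst0] := deg_lead a0; set cst := cf _ u in cst0.
have dp0 : (0 < deg (p j0 0%R))%N by rewrite lt0n deg_eq0.
(* The error of stripping [u] from the left factor only. If [a 0 j] has at least the degree of
   [a 0 j0], maximality of the sum bounds [p j 0]; otherwise [u] wipes out [a 0 j], and minimality
   of [j0] makes [sum j] strictly smaller. *)
pose rho j := ldw u (a 0 j * p j 0) - ldw u (a 0 j) * p j 0.
have rho_deg j : (deg (rho j) <= (deg (p j0 0%R)).-1)%N.
  case: (eqVneq (a 0 j) 0) => [aj|aj]; first by rewrite /rho aj mul0r ldw0 mul0r subrr deg0.
  case: (eqVneq (p j 0) 0) => [pj|pj].
    by apply: leq_trans (deg_ldwM _ _ _) _; rewrite pj deg0.
  have Pj : P j by rewrite /P aj pj.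
  have := max1 j Pj; rewrite -sum0 /sum -Hu => le.
  case: (ltnP (size u) (deg (a 0%R j))) => lt.
    by apply: leq_trans (deg_ldwM _ _ _) _; lia.
  have -> : rho j = ldw u (a 0 j * p j 0).
    have /eqP : deg (ldw u (a 0 j)) == 0%N by rewrite -leqn0; apply: deg_ldw.
    by move/eqP; rewrite deg_eq0 /rho => /eqP ->; rewrite mul0r subr0.
  apply: deg_ldw; rewrite degM //.
  have ne : sum j != sum j1.
    by apply/negP => E; have := min0 j; rewrite /Q Pj E -Hu => /(_ isT); lia.
  by move: ne; rewrite -sum0 /sum -Hu; lia.
exists j0, (\row_j if j == j0 then 0 else cst^-1 *: ldw u (a 0 j)); split.
  by rewrite mxE eqxx.
have -> : p j0 0 + ((\row_j (if j == j0 then 0 else cst^-1 *: ldw u (a 0 j))) *m p) 0 0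
    = cst^-1 *: \sum_j - rho j.
  have S0 : \sum_j ldw u (a 0 j * p j 0) = 0.
    rewrite -ldw_sum; have := congr1 (fun M : 'M_1 => M 0 0) ap0.
    by rewrite !mxE => ->; rewrite ldw0.
  have -> : \sum_j - rho j = \sum_j ldw u (a 0 j) * p j 0.
    transitivity (\sum_j (ldw u (a 0 j) * p j 0 - ldw u (a 0 j * p j 0))).
      by apply: eq_bigr => j _; rewrite /rho opprB.
    by rewrite sumrB S0 subr0.
  rewrite mxE scaler_sumr (bigD1 j0) //= mxE eqxx mul0r add0r [RHS](bigD1 j0) //=.
  congr (_ + _).
    have -> : ldw u (a 0 j0) = cst%:A.
      by rewrite (@deg_le1 _ _ _ (ldw u _)) ?cf_ldw ?cats0 //; apply: deg_ldw; rewrite -Hu.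
    by rewrite mulr_algl scalerA mulVf // scale1r.
  by apply: eq_bigr => j ne; rewrite mxE (negbTE ne) scalerAl.
rewrite -[X in (_ < X)%N]prednK // ltnS; apply: degZ; apply: deg_sum => j _.
by rewrite -scaleN1r; apply: degZ.
Qed.

(* Cohn's weak algorithm, run on the column [p]: elementary operations leave at
   most one nonzero entry, because the constant term of [L] stays invertible
   while [L *m p] has all its entries on one line. *)
Lemma column_gcd m (p : 'cV[A]_m) (L : 'M[A]_m) (c : 'cV[F]_m) G :
  map_mx aug L \in unitmx -> L *m p = \col_i (c i 0 *: G) -> p != 0 ->
  exists q, [/\ forall i, exists s, p i 0 = s * q,
    exists t : 'rV[A]_m, q = (t *m p) 0 0 & exists s, G = s * q].
Proof.
have [N] := ubnP (\sum_i deg (p i 0%R))%N; elim: N p L => // N IHN p L; rewrite ltnS => HN.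
move=> uL Lp p0.
case: (classic (exists a : 'rV[A]_m, a *m p = 0 /\ exists j, (a 0 j != 0) && (p j 0 != 0))).
  move=> [a [ap0 Hj]]; have [j0 [b [bj0 Hb]]] := reduce_dependent ap0 Hj.
  pose e : 'cV[A]_m := delta_mx j0 0.
  have be : b *m e = 0.
    by apply/matrixP => i j; rewrite !ord1 -colE !mxE.
  have E1 : (1%:M - e *m b) *m (1%:M + e *m b) = 1%:M.
    rewrite mulmxBl mul1mx mulmxDr mulmx1 mulmxA -(mulmxA e b e) be mulmx0 mul0mx addr0.
    by rewrite addrK.
  pose p' := (1%:M + e *m b) *m p.
  have Ep : p = (1%:M - e *m b) *m p' by rewrite mulmxA E1 mul1mx.
  have Ep' i : p' i 0 = if i == j0 then p j0 0 + (b *m p) 0 0 else p i 0.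
    rewrite /p' mulmxDl mul1mx -mulmxA mxE [X in _ + X]mxE big_ord1 mxE eqxx andbT.
    by case: eqP => [->|_]; rewrite ?mul1r // mul0r addr0.
  case: (IHN p' (L *m (1%:M - e *m b))).
  - apply: leq_trans HN; rewrite [ltnRHS](bigD1 j0) //= (bigD1 j0) //= Ep' eqxx.
    rewrite -addSn leq_add // leq_eqVlt; apply/orP; left; apply/eqP.
    by apply: eq_bigr => i ne; rewrite Ep' (negbTE ne).
  - rewrite map_mxM unitmx_mul uL /=.
    have := congr1 (map_mx aug) E1; rewrite map_mxM map_mx1.
    by move=> /mulmx1_unit[].
  - by rewrite -mulmxA -Ep.
  - by apply: contra_neq p0 => E; rewrite Ep E mulmx0.
  move=> q [Hq [t Ht] HG]; exists q; split=> //.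
    move=> i; have [s Hs] := fin_all_exists Hq.
    exists (\sum_j (1%:M - e *m b) i j * s j); rewrite {1}Ep mxE mulr_suml.
    by apply: eq_bigr => j _; rewrite Hs mulrA.
  by exists (t *m (1%:M + e *m b)); rewrite -mulmxA.
move=> indep.
have {}indep (a : 'rV[A]_m) j : a *m p = 0 -> p j 0 != 0 -> a 0 j = 0.
  move=> ap0 pj; apply/eqP/negP => /negP aj; apply: indep; exists a; split=> //.
  by exists j; rewrite aj pj.
(* A constant row killing [t] is the constant term of a row killing [p], so by [indep] it vanishes
   wherever [p] does not. Two nonzero entries of [p] would give such a row supported on both. *)
pose M := map_mx aug L; pose t := invmx M *m c.
have key (x : 'rV[F]_m) j : x *m t = 0 -> p j 0 != 0 -> x 0 j = 0.
  move=> xt pj; have [z zc ->] : exists2 z, z *m c = 0 & x = z *m M.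
    by exists (x *m invmx M); rewrite ?mulmxKV // -mulmxA.
  have : (map_mx (fun x : F => x%:A : A) z *m L) 0 j = 0.
    apply: indep => //; rewrite -mulmxA Lp; apply/matrixP => i k.
    have := congr1 (fun M : 'M_1 => M 0 0) zc; rewrite !mxE !ord1 => zc0.
    under eq_bigr => l _ do rewrite !mxE mulr_algl scalerA.
    by rewrite -scaler_suml zc0 scale0r.
  have Ez : map_mx aug (map_mx (fun x : F => x%:A : A) z) = z.
    by apply/matrixP => i k; rewrite !mxE /aug cfZ cf1 mulr1.
  move=> /(congr1 aug); rewrite rmorph0 => <-.
  transitivity ((map_mx aug (map_mx (fun x : F => x%:A : A) z *m L)) 0 j); last by rewrite mxE.
  by rewrite map_mxM Ez.
have tE : t = invmx M *m c by [].
clearbody t.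
have tj j : p j 0 != 0 -> t j 0 != 0.
  move=> pj; apply/negP => /eqP tj0.
  have /eqP : (delta_mx 0 j : 'rV[F]_m) 0 j = 0.
    apply: key => //; rewrite -rowE; apply/matrixP => i k.
    by rewrite !ord1 mxE tj0 mxE.
  by rewrite mxE !eqxx oner_eq0.
have [j0 pj0] : exists j, p j 0 != 0.
  apply: NNPP => H; move: p0 => /negP; apply; apply/eqP/matrixP => i k.
  by rewrite ord1 [RHS]mxE; apply/eqP/negP => /negP Hi; apply: H; exists i.
have uniq j : p j 0 != 0 -> j = j0.
  move=> pj; apply/eqP/negP => /negP ne.
  have /eqP : (t j0 0 *: delta_mx 0 j - t j 0 *: delta_mx 0 j0 : 'rV[F]_m) 0 j = 0.
    apply: key => //; rewrite mulmxBl -!scalemxAl -!rowE; apply/matrixP => i k.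
    by rewrite !ord1 !mxE mulrC subrr.
  by rewrite !mxE !eqxx (negbTE ne) andbF mulr0 subr0 mulr1 (negbTE (tj _ pj0)).
exists (p j0 0); split.
- move=> i; case: (eqVneq (p i 0) 0) => [->|/uniq ->].
    by exists 0; rewrite mul0r.
  by exists 1; rewrite mul1r.
- by exists (delta_mx 0 j0); rewrite -rowE mxE.
have [i ci] : exists i, c i 0 != 0.
  apply: NNPP => H; move: (tj _ pj0) => /negP; apply; apply/eqP.
  suff -> : t = 0 by rewrite mxE.
  rewrite tE; suff -> : c = 0 by rewrite mulmx0.
  apply/matrixP => i k; rewrite ord1 [RHS]mxE; apply/eqP/negP => /negP Hi.
  by apply: H; exists i.
exists ((c i 0)^-1 *: L i j0).
have := congr1 (fun M : 'cV_m => M i 0) Lp; rewrite !mxE (bigD1 j0) //= big1 ?addr0 => [|j ne].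
  by rewrite -scalerAl => ->; rewrite scalerA mulVf // scale1r.
case: (eqVneq (p j 0) 0) => [->|/uniq E]; first by rewrite mulr0.
by rewrite E eqxx in ne.
Qed.

End WeakAlgorithm.

(** * Modules of irreducible polynomials *)

Section AtomicModules.
Variables (F : fieldType) (d : nat) (A : freeAlg F d).
Implicit Types (G H p q r s a b : A) (w u v : seq 'I_d) (c : F).

Lemma mem_nth_ord (l : seq A) (j : 'I_(size l)) : l`_j \in l.
Proof. exact: mem_nth. Qed.

(* Simplicity of the socle: the left ideal generated by [S] contains [G] and is
   principal by [column_gcd], so irreducibility makes it the whole algebra. *)
Lemma atomic_stable_one G S : atomic G -> (1 < deg G)%N -> cf G [::] = 1 ->
  stable G S -> (exists p, [/\ S p, p != 0 & (deg p < deg G)%N]) -> S 1.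
Proof.
move=> atG dG G1 HS [p0 [Sp0 p0n dp0]]; have [HS' ST] := HS.
have dG' : ((deg G).-1.+1 = deg G)%N by apply: ltn_predK dG.
pose S' p := S p /\ (deg p < deg G)%N.
have HS'' : subspace S'.
  split; first by split; [case: HS' | rewrite deg0 ltnW].
  move=> c p q [Sp dp] [Sq dq]; split; first by case: HS' => _; apply.
  by move: dp dq; rewrite -dG' !ltnS => dp dq; apply: degD => //; apply: degZ.
have [b bS' bspan] : exists2 b : seq A, {in b, forall x, S' x} &
    forall p, S' p -> exists c : 'I_(size b) -> F, p = \sum_j c j *: b`_j.
  by apply: (@subspace_deg_basis _ _ _ (deg G)) => // p [_ /ltnW].
have Hrs i (j : 'I_(size b)) : exists c : 'I_(size b) -> F, rs G i b`_j = \sum_l c l *: b`_l.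
  apply: bspan; have [Sb db] := bS' _ (mem_nth_ord j); split; first exact: ST.
  by move: db; rewrite -dG' !ltnS => db; apply: deg_rs; rewrite dG' // ltnW // -dG'.
have [N HN] := fin_all_exists (fun i => fin_all_exists (Hrs i)).
pose p : 'cV[A]_(size b) := \col_j b`_j.
(* The linear pencil of the submodule: [b_j - sum_i x_i (rs G i b_j) = b_j(0) G] puts [L *m p] on
   the line of [G]. *)
pose L : 'M[A]_(size b) := \matrix_(j, l) ((j == l)%:R - \sum_i N i j l *: mon [:: i]).
have augL : map_mx (@aug _ _ _) L = 1%:M.
  apply/matrixP => j l; rewrite !mxE rmorphB /= rmorph_nat rmorph_sum big1 ?subr0 //.
  by move=> i _; rewrite /= /aug cfZ cf_mon mulr0.
have Lp : L *m p = \col_j ((\col_j cf b`_j [::]) j 0 *: G).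
  apply/matrixP => j k; rewrite !mxE.
  have -> : \sum_l L j l * p l k = b`_j - \sum_i mon [:: i] * rs G i b`_j.
    under eq_bigr => l _ do rewrite !mxE mulrBl mulr_suml.
    rewrite sumrB; congr (_ - _).
      rewrite (bigD1 j) //= eqxx mul1r big1 ?addr0 // => l ne.
      by rewrite eq_sym (negbTE ne) mul0r.
    rewrite exchange_big; apply: eq_bigr => i _ /=; rewrite HN mulr_sumr.
    by apply: eq_bigr => l _; rewrite scaleAr scalerAl.
  by rewrite -rs_expand // subKr.
have pn0 : p != 0.
  apply: contraNneq p0n => p_0; have [c ->] := bspan p0 (conj Sp0 dp0).
  rewrite big1 // => j _; have := congr1 (fun M : 'cV_(size b) => M j 0) p_0.
  by rewrite !mxE => ->; rewrite scaler0.
have [|q [Hq [t Ht] [s Hs]]] := column_gcd _ Lp pn0; first by rewrite augL unitmx1.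
have G0 : G != 0 by rewrite -deg_eq0 -dG'.
have s0 : s != 0 by apply: contraNneq G0 => s0; rewrite Hs s0 mul0r.
have q0 : q != 0 by apply: contraNneq G0 => q0; rewrite Hs q0 mulr0.
(* If [s] is the constant factor, [q] has the degree of [G] and yet right-divides a nonzero basis
   vector of smaller degree. *)
case: (atG s q Hs) => [ds|dq].
  have dGq : (deg G <= deg q)%N.
    rewrite Hs degM //; move: ds; rewrite leq_eqVlt ltnS leqn0 deg_eq0 (negbTE s0) orbF.
    by move=> /eqP ->.
  have [j pj] : exists j : 'I_(size b), b`_j != 0.
    apply: NNPP => H; move: pn0 => /negP; apply; apply/eqP/matrixP => i k.
    by rewrite !mxE; apply/eqP/negP => /negP Hi; apply: H; exists i.
  have [s' Hs'] := Hq j; have [_] := bS' _ (mem_nth_ord j).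
  rewrite ltnNge; move: pj; rewrite mxE in Hs'; rewrite Hs' => sq.
  have s'0 : s' != 0 by apply: contraNneq sq => ->; rewrite mul0r.
  rewrite degM // => /negP[]; apply: leq_trans dGq _.
  by move: s'0; rewrite -deg_eq0; case: (deg s') => // n _; rewrite addSn /= leq_addl.
have qE := deg_le1 dq; set c := cf q [::] in qE.
have c0 : c != 0 by apply: contraNneq q0 => c0; rewrite qE c0 scale0r.
(* So [1] is a left combination of vectors of [S], and a long enough word carries it into [S]. *)
have [n Hn] : exists n, fil S n (\sum_j t 0 j * b`_j).
  have Hj (j : 'I_(size b)) : exists n, fil S n (t 0 j * b`_j).
    by apply: fil_mul => //; have [] := bS' _ (mem_nth_ord j).
  have [n Hn] := fin_all_exists Hj; exists (\max_j n j)%N.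
  apply: subspace_sum => [|j _]; first exact: fil_subspace.
  by apply: fil_leq (Hn j) => //; apply: (@leq_bigmax _ n).
have {}Hn : fil S n 1.
  have -> : 1 = c^-1 *: \sum_j t 0 j * b`_j; last by apply: subspaceZ => //; apply: fil_subspace.
  have -> : \sum_j t 0 j * b`_j = q by rewrite Ht mxE; apply: eq_bigr => j _; rewrite mxE.
  by rewrite qE scalerA mulVf // scale1r.
by apply: (@one_of_deep_words _ _ _ G S n) => // w Hw; apply: fil_rsw Hn Hw.
Qed.

Definition nonunit_atom G := [/\ atomic G, (1 < deg G)%N & cf G [::] = 1].

Definition kills Gf s := forall r, act Gf 1 (r * s) = 0.

(* Peel off [l] one vector at a time, keeping the [s] in [R] that kill it, up to
   the last step at which [R] still moves [1]: there [b s |-> 1 s] is well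
   defined, and it is the homomorphism sought. *)
Lemma orbit_hom Gf Gg (l : seq A) (R : A -> Prop) :
  nonunit_atom Gf -> nonunit_atom Gg ->
  {in l, forall x, exists r, x = act Gf 1 r} ->
  subspace R -> (forall s r, R s -> R (s * r)) ->
  (exists2 s, R s & act Gg 1 s != 0) ->
  (forall s, R s -> {in l, forall x, act Gf x s = 0} -> act Gg 1 s = 0) ->
  exists a, [/\ a != 0, (deg a < deg Gg)%N & forall r, act Gf 1 r = 0 -> act Gg a r = 0].
Proof.
move=> [atf df f1] [atg dg g1]; elim: l R => [|b l IHl] R Hl HR HRM [s0 Rs0 s0n] HRl.
  by rewrite HRl ?eqxx in s0n.
have [R0 RD] := HR.
case: (classic (exists2 s, R s /\ act Gf b s = 0 & act Gg 1 s != 0)) => [Hs|no].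
  apply: (IHl (fun s => R s /\ act Gf b s = 0)) => //.
  - by move=> x xl; apply: Hl; rewrite in_cons xl orbT.
  - split; first by rewrite act0s.
    move=> c p q [Rp p0] [Rq q0]; split; first exact: RD.
    by rewrite actDs actZs p0 q0 scaler0 addr0.
  - by move=> s r [Rs s0']; split; [apply: HRM | rewrite actM s0' act0p].
  - move=> s [Rs bs] H; apply: HRl => // x; rewrite in_cons => /orP[/eqP ->|] //; exact: H.
have {}no s : R s -> act Gf b s = 0 -> act Gg 1 s = 0.
  move=> Rs bs; apply/eqP/negP => /negP sn; apply: no; by exists s.
have [rb Hrb] := Hl b (mem_head _ _).
have [s1 Rs1 Hs1] : exists2 s, R s & 1 = act Gf b s.
  apply: (@atomic_stable_one Gf (fun p => exists2 s, R s & p = act Gf b s)) => //.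
    split; first split; first by exists 0; rewrite ?act0s.
      move=> c p q [s Rs ->] [r Rr ->]; exists (c *: s + r); first exact: RD.
      by rewrite actDs actZs.
    by move=> i p [s Rs ->]; exists (s * mon [:: i]); [apply: HRM | rewrite actM act_x].
  exists (act Gf b s0); split; first by exists s0.
    by apply: contraNneq s0n => /(no _ Rs0) ->.
  by rewrite Hrb -actM; apply: deg_act1.
exists (act Gg 1 s1); split; last 1 first.
- by move=> r Hr; rewrite -actM; apply: no; [apply: HRM | rewrite actM -Hs1].
- apply: contraNneq s0n => a0; pose r' := rb * s0.
  have : act Gg 1 (s0 - s1 * r') = 0.
    apply: no; last by rewrite actBs actM -Hs1 /r' actM -Hrb subrr.
    by apply: subspaceB => //; apply: HRM.
  by rewrite actBs actM a0 act0p subr0 => ->.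
exact: deg_act1.
Qed.

(** The vectors [1 . s] in the module of [Gg], for [s] in [kills Gf], form a submodule. If it is
    nonzero, it contains [1] and some [s] separates; if it is zero, a finite basis of the submodule
    generated by [1] for [Gf] is fed to [orbit_hom]. *)
Lemma separate_or_hom Gf Gg : nonunit_atom Gf -> nonunit_atom Gg ->
  (exists s, kills Gf s /\ act Gg 1 s = 1) \/
  (exists a, [/\ a != 0, (deg a < deg Gg)%N & forall r, act Gf 1 r = 0 -> act Gg a r = 0]).
Proof.
move=> Hf Hg; case: (classic (exists s, kills Gf s /\ act Gg 1 s = 1)); first by left.
move=> no; right; have [[atf df f1] [atg dg g1]] := (Hf, Hg).
have killsD : subspace (kills Gf).
  split; first by move=> r; rewrite mulr0 act0s.
  by move=> c p q Hp Hq r; rewrite mulrDr scaleAr actDs actZs Hp Hq scaler0 addr0.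
have nil s : kills Gf s -> act Gg 1 s = 0.
  move=> Ks; apply/eqP/negP => /negP s0; apply: no.
  suff [r Kr Hr] : exists2 r, kills Gf r & 1 = act Gg 1 r by exists r.
  apply: (@atomic_stable_one Gg (fun p => exists2 s, kills Gf s & p = act Gg 1 s)) => //.
    split; first split; first by exists 0; rewrite ?act0s //; case: killsD.
      move=> c p q [r Kr ->] [r' Kr' ->]; exists (c *: r + r'); first by case: killsD => _; apply.
      by rewrite actDs actZs.
    move=> i p [r Kr ->]; exists (r * mon [:: i]); last by rewrite actM act_x.
    by move=> r'; rewrite mulrA actM Kr act0p.
  exists (act Gg 1 s); split=> //; first by exists s.
  exact: deg_act1.
have orbS : subspace (fun p => exists r, p = act Gf 1 r).
  split; first by exists 0; rewrite act0s.
  by move=> c p q [r ->] [r' ->]; exists (c *: r + r'); rewrite actDs actZs.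
have [b bS bspan] : exists2 b : seq A, {in b, forall x, exists r, x = act Gf 1 r} &
    forall p, (exists r, p = act Gf 1 r) -> exists c : 'I_(size b) -> F, p = \sum_j c j *: b`_j.
  apply: (@subspace_deg_basis _ _ _ (deg Gf)) => // p [r ->].
  exact/ltnW/deg_act1.
apply: (orbit_hom (l := b) (R := fun=> True)) => //.
  by exists 1; rewrite // act1 -deg_eq0; apply/negP => /eqP; rewrite /= => E; have := cf1 A [::]; rewrite cf_deg ?E // => /eqP; rewrite eq_sym oner_eq0.
move=> s _ Hs; apply: nil => r; rewrite actM.
have [|c ->] := bspan (act Gf 1 r); first by exists r.
by rewrite act_sum_p big1 // => j _; rewrite actZp Hs ?scaler0 // mem_nth_ord.
Qed.

(* Modulo the submodule generated by [1], letters act as plain backward shifts,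
   so an [s] without constant term acts nilpotently. *)
Lemma killed_no_fixed G s (v : A) : (0 < deg G)%N -> kills G s -> cf s [::] = 0 ->
  act G v s = v -> v = 0.
Proof.
move=> dG Ks s0 Hv; pose U p := exists r, p = act G 1 r.
pose Q n p := exists q r, [/\ U q, (deg r <= n)%N & p = q + r].
have US : subspace U.
  split; first by exists 0; rewrite act0s.
  by move=> c p q [r ->] [r' ->]; exists (c *: r + r'); rewrite actDs actZs.
have QS n : subspace (Q n).
  split; first by exists 0, 0; split; rewrite ?deg0 ?addr0 //; case: US.
  move=> c p q [p1 [p2 [Up dp ->]]] [q1 [q2 [Uq dq ->]]].
  exists (c *: p1 + q1), (c *: p2 + q2); split; first by case: US => _; apply.
    by apply: degD => //; apply: degZ.
  by rewrite scalerDr addrACA.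
have Qrs n i p : Q n p -> Q n.-1 (rs G i p).
  move=> [q [r [[t ->] dr ->]]].
  exists (act G 1 (t * mon [:: i] + cf r [::] *: mon [:: i])), (ld i r); split.
  - by exists (t * mon [:: i] + cf r [::] *: mon [:: i]).
  - case: n dr => [|n] dr; last exact: deg_ld.
    by move: dr; rewrite leqn0 deg_eq0 => /eqP ->; rewrite linear0 deg0.
  - by rewrite actDs actZs actM !act_x rs1 linearD /= [rs G i r]rsE scalerN addrAC addrA.
have Qst n : stable G (Q n).
  split=> // i p /(Qrs n i) [q [r [Uq dr ->]]]; exists q, r; split=> //.
  exact: leq_trans dr (leq_pred n).
have Qact n p : Q n p -> Q n.-1 (act G p s).
  move=> Qp; rewrite (ld_expand s) s0 scale0r add0r act_sum_s.
  apply: subspace_sum => // i _; rewrite actM act_x.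
  by apply: (stable_act _ (Qst _)); apply: Qrs.
have Qv n : Q (deg v - n)%N v.
  elim: n => [|n IHn]; last by rewrite subnS -[v in Q _ v]Hv; apply: Qact.
  by exists 0, v; rewrite add0r subn0; split=> //; case: US.
have := Qv (deg v); rewrite subnn => -[q [r [[t ->]]]].
rewrite leqn0 deg_eq0 => /eqP -> E.
by rewrite -Hv E addr0 -actM Ks.
Qed.

End AtomicModules.

(** * Matrix points *)

Section Evaluation.
Variables (F : fieldType) (d : nat) (A : freeAlg F d).
Implicit Types (G H p q r s : A) (w u v : seq 'I_d) (c : F).

Section Ev.
Variables (n : nat) (X : {ffun 'I_d -> 'M[F]_n.+1}).

Definition ev : A -> 'M[F]_n.+1 := lin (fun w => \prod_(i <- w) X i).
HB.instance Definition _ := GRing.Linear.on ev.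

Lemma ev_mon w : ev (mon w) = \prod_(i <- w) X i.
Proof. exact: lin_mon. Qed.

Lemma ev1 : ev 1 = 1.
Proof. by rewrite -mon_nil ev_mon big_nil. Qed.

Lemma evM p q : ev (p * q) = ev p * ev q.
Proof.
elim/freeAlg_ind: p => [|p p' Hp Hp'|c u].
- by rewrite mul0r linear0 mul0r.
- by rewrite mulrDl !linearD /= Hp Hp' mulrDl.
elim/freeAlg_ind: q => [|q q' Hq Hq'|c' v].
- by rewrite mulr0 linear0 mulr0.
- by rewrite mulrDr !linearD /= Hq Hq' mulrDr.
by rewrite -scalerAl scaleAr !linearZ /= monM !ev_mon big_cat -scalerAl -scalerAr.
Qed.

End Ev.

(* [X] is the matrix form of the module of [H]. *)
Lemma realization H : exists N (X : {ffun 'I_d -> 'M[F]_N.+1}), forall G,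
  ((exists q, [/\ q != 0, (deg q <= (deg H).+1)%N & act H q G = 0]) <-> \det (ev X G) = 0).
Proof.
(* With the bound [n.+1] the empty word is listed even for [H = 0], so the matrix size is a
   successor. *)
pose n := deg H; pose ws := words d n.+1.
have [N HN] : exists N, size ws = N.+1 by eexists.
pose wd (j : 'I_N.+1) := nth [::] ws j.
have wd_lt j : (size (wd j) < n.+1)%N.
  by rewrite -mem_words mem_nth // HN.
have wd_inj : injective wd.
  by move=> i j /eqP; rewrite nth_uniq ?HN ?words_uniq // => /eqP/val_inj.
pose vp (u : 'rV[F]_N.+1) : A := \sum_j u 0 j *: mon (wd j).
have cf_vp (u : 'rV_N.+1) l : cf (vp u) (wd l) = u 0 l.
  rewrite cf_sum (bigD1 l) //= cfZ cf_mon eqxx mulr1 big1 ?addr0 // => j ne.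
  by rewrite cfZ cf_mon (inj_eq wd_inj) (negbTE ne) mulr0.
have deg_vp (u : 'rV_N.+1) : (deg (vp u) <= n.+1)%N.
  by apply: deg_sum => j _; apply: degZ; apply: leq_trans (deg_mon _ _) (wd_lt j).
have vpK p : (deg p <= n.+1)%N -> vp (\row_j cf p (wd j)) = p.
  move=> dp; rewrite [RHS](cf_expand dp) (big_nth [::]) -/ws HN big_mkord.
  by apply: eq_bigr => j _; rewrite mxE.
have vpL : linear vp.
  move=> c u v; rewrite scaler_sumr -big_split; apply: eq_bigr => j _ /=.
  by rewrite !mxE scalerDl scalerA.
pose X : {ffun 'I_d -> 'M[F]_N.+1} := [ffun i => \matrix_(j, l) cf (rs H i (mon (wd j))) (wd l)].
have vpX (u : 'rV_N.+1) i : vp (u *m X i) = rs H i (vp u).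
  rewrite -[RHS]vpK; last by apply: leqW; apply: deg_rs => //; apply: leqW.
  congr vp; apply/matrixP => k l; rewrite ord1 !mxE linear_sum cf_sum.
  by apply: eq_bigr => j _; rewrite linearZ /= cfZ ffunE mxE.
pose vpl := GRing.isLinear.Build F 'rV[F]_N.+1 A *:%R vp vpL.
pose vpL' : {linear 'rV[F]_N.+1 -> A} := HB.pack vp vpl.
have vpE (u : 'rV_N.+1) G : vp (u *m ev X G) = act H (vp u) G.
  elim/freeAlg_ind: G => [|p q Hp Hq|c w].
  - by rewrite act0s linear0 mulmx0 -[LHS]/(vpL' 0) linear0.
  - by rewrite actDs linearD /= mulmxDr -[LHS]/(vpL' (_ + _)) linearD /= Hp Hq.
  rewrite actZs linearZ /= -scalemxAr -[LHS]/(vpL' (_ *: _)) linearZ /=; congr (_ *: _).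
  rewrite ev_mon act_mon; elim: w u => [|i w IHw] u; first by rewrite big_nil mulmx1.
  by rewrite big_cons mulmxA IHw vpX.
have vp_inj (u : 'rV_N.+1) : vp u = 0 -> u = 0.
  by move=> E; apply/matrixP => k l; rewrite ord1 -cf_vp E cf0 mxE.
exists N, X => G; split=> [[q [q0 dq Hq]]|/eqP/det0P[u u0 Hu]].
  apply/eqP/det0P; exists (\row_j cf q (wd j)).
    by apply: contraNneq q0 => E; rewrite -(vpK q dq) E -[vp 0]/(vpL' 0) linear0.
  by apply: vp_inj; rewrite vpE vpK ?Hq.
exists (vp u); split; last by rewrite -vpE Hu -[LHS]/(vpL' 0) linear0.
  by apply: contraNneq u0 => /vp_inj ->.
exact: deg_vp.
Qed.

(** Multiplying [s] by an [r] without constant term that fixes [1] gives [H(0) = 1], as duality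
    requires. If [Gf] were singular on the module of [H = 1 - s * r], duality would produce a
    nonzero vector fixed by [s * r], against [killed_no_fixed]. *)
Lemma separating_point Gf Gg s : cf Gf [::] = 1 -> nonunit_atom Gg ->
  (0 < deg Gf)%N -> kills Gf s -> act Gg 1 s = 1 ->
  exists N (X : {ffun 'I_d -> 'M[F]_N.+1}), \det (ev X Gg) = 0 /\ \det (ev X Gf) != 0.
Proof.
move=> f1 [atg dg g1] df Ks Hs.
have [r r0 Hr] := augmentation_generates dg g1.
pose t := s * r; have Kt : kills Gf t by move=> q; rewrite mulrA actM Ks act0p.
have t0 : cf t [::] = 0 by rewrite cfM_nil r0 mulr0.
have t1 : act Gg 1 t = 1 by rewrite actM Hs Hr.
pose H : A := 1 - t; have H1 : cf H [::] = 1 by rewrite cfB cf1 t0 subr0.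
have [N [X HX]] := realization H; exists N, X; split.
  apply/HX; have [|q [q0 dq Hq]] := @act_duality _ _ _ Gg H 1 g1 H1 (oner_neq0 _).
    by rewrite actBs act1 t1 subrr.
  by exists q; split=> //; rewrite ltnW // ltnW.
apply/negP => /eqP/HX[q [q0 _ Hq]].
have [v [v0 _]] := act_duality H1 f1 q0 Hq.
rewrite actBs act1 => /eqP; rewrite subr_eq0 eq_sym => /eqP Hv.
by rewrite (killed_no_fixed df Kt t0 Hv) eqxx in v0.
Qed.

End Evaluation.

Section Scaling.
Variables (F : fieldType) (d : nat) (A : freeAlg F d).

Lemma deg_scale (c : F) (p : A) : c != 0 -> deg (c *: p) = deg p.
Proof.
move=> c0; apply/eqP; rewrite eqn_leq degZ //=.
by rewrite -{1}[p](scalerK c0) degZ.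
Qed.

Lemma deg_factor_ge (p q : A) : p * q != 0 -> (deg q <= deg (p * q)%R)%N.
Proof.
move=> pq0; have p0 : p != 0 by apply: contraNneq pq0 => ->; rewrite mul0r.
have q0 : q != 0 by apply: contraNneq pq0 => ->; rewrite mulr0.
by rewrite degM //; move: p0; rewrite -deg_eq0; case: (deg p) => // n _; rewrite addSn leq_addl.
Qed.

Lemma deg_factor_le1 (p q : A) : p * q != 0 -> (deg (p * q)%R <= 1)%N ->
  (deg p <= 1)%N /\ (deg q <= 1)%N.
Proof.
move=> pq0; have p0 : p != 0 by apply: contraNneq pq0 => ->; rewrite mul0r.
have q0 : q != 0 by apply: contraNneq pq0 => ->; rewrite mulr0.
by rewrite degM //; move: p0 q0; rewrite -!deg_eq0; lia.
Qed.

End Scaling.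

(** * Extension of scalars to the function field *)

Section BaseChange.
Variables (F K : fieldType) (phi : {rmorphism F -> K}) (d : nat).
Variables (A : freeAlg F d) (B : freeAlg K d).
Implicit Types (p q : A).

Definition cmap p : B := \sum_(w <- words d (deg p)) phi (cf p w) *: mon w.

Lemma cf_cmap p w : cf (cmap p) w = phi (cf p w).
Proof.
rewrite (cf_sum_words B (deg p) (fun w => phi (cf p w))); case: ltnP => // /cf_deg ->.
by rewrite rmorph0.
Qed.

Lemma cmap_is_zmod_morphism : zmod_morphism cmap.
Proof. by move=> p q; apply: cfP => w; rewrite cfB !cf_cmap cfB rmorphB. Qed.
HB.instance Definition _ := GRing.isZmodMorphism.Build A B cmap cmap_is_zmod_morphism.

Lemma cmapZ c p : cmap (c *: p) = phi c *: cmap p.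
Proof. by apply: cfP => w; rewrite cfZ !cf_cmap cfZ rmorphM. Qed.

Lemma cmap_mon w : cmap (mon w) = mon w.
Proof. by apply: cfP => u; rewrite cf_cmap !cf_mon rmorph_nat. Qed.

Lemma cmap_is_monoid_morphism : monoid_morphism cmap.
Proof.
split=> [|p q]; first by rewrite -!mon_nil cmap_mon.
elim/freeAlg_ind: p => [|p p' Hp Hp'|c u].
- by rewrite mul0r !raddf0 mul0r.
- by rewrite mulrDl !raddfD /= Hp Hp' mulrDl.
elim/freeAlg_ind: q => [|q q' Hq Hq'|c' v].
- by rewrite mulr0 !raddf0 mulr0.
- by rewrite mulrDr !raddfD /= Hq Hq' mulrDr.
by rewrite -scalerAl scaleAr !cmapZ !cmap_mon monM !cmap_mon -scalerAl scaleAr monM.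
Qed.
HB.instance Definition _ := GRing.isMonoidMorphism.Build A B cmap cmap_is_monoid_morphism.

Lemma deg_cmap p : (deg (cmap p) <= deg p)%N.
Proof. by apply/deg_leP => w /cf_deg; rewrite cf_cmap => ->; rewrite rmorph0. Qed.

End BaseChange.

Section FunctionField.
Variables (k : closedFieldType) (K : fieldType) (iota : {rmorphism {poly k} -> K}).
Hypothesis iota_inj : injective iota.
Hypothesis iota_frac : forall x : K, exists n d : {poly k}, d != 0 /\ x = iota n / iota d.
Variables (d : nat) (A : freeAlg k d) (B : freeAlg K d).

Let iota_eq0 c : (iota c == 0) = (c == 0).
Proof. by rewrite -(rmorph0 iota) (inj_eq iota_inj). Qed.

Definition phi : k -> K := iota \o polyC.
HB.instance Definition _ := GRing.RMorphism.on phi.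

Local Notation lam := (iota 'X).
Local Notation cmap := (@cmap k K phi d A B).

Lemma lam_comm : commr_rmorph cmap (lam%:A : B).
Proof. by move=> p; rewrite /GRing.comm mulr_algl -[cmap p in RHS]mulr1 -mulrA mul1r scaleAr mulr1. Qed.

(** Inside [B], [{poly A}] is [A[t]]: there the factor theorem and evaluation at elements of [A] are
    available. *)
Definition emb : {poly A} -> B := horner_morph lam_comm.
HB.instance Definition _ := GRing.RMorphism.on emb.

Lemma embX : emb 'X = lam%:A.
Proof. exact: horner_morphX. Qed.
Lemma embC p : emb p%:P = cmap p.
Proof. exact: horner_morphC. Qed.

Definition cfpoly (w : seq 'I_d) (P : {poly A}) : {poly k} := \poly_(i < size P) cf P`_i w.

Lemma coef_cfpoly w P i : (cfpoly w P)`_i = cf P`_i w.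
Proof.
by rewrite coef_poly; case: ltnP => // le; rewrite (nth_default _ le) cf0.
Qed.

Lemma cf_emb P w : cf (emb P) w = iota (cfpoly w P).
Proof.
elim/poly_ind: P => [|P p IH].
  rewrite rmorph0 cf0 (_ : cfpoly w 0 = 0) ?rmorph0 //.
  by apply/polyP => i; rewrite coef_cfpoly !coef0 cf0.
rewrite rmorphD rmorphM /= embX embC cfD -[emb P]mulr1 -mulrA mul1r scaleAr mulr1 cfZ IH cf_cmap.
rewrite (_ : cfpoly w (P * 'X + p%:P) = cfpoly w P * 'X + (cf p w)%:P).
  by rewrite rmorphD rmorphM /= mulrC.
apply/polyP => i; rewrite coef_cfpoly !coefD !coefMX !coefC cfD coef_cfpoly.
by case: i => [|i] //=; rewrite cf0.
Qed.

Lemma emb_inj : injective emb.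
Proof.
move=> P Q /eqP; rewrite -subr_eq0 -rmorphB /= => /eqP E; apply/eqP; rewrite -subr_eq0.
apply/eqP/polyP => i; rewrite coef0; apply: cfP => w; rewrite cf0 -coef_cfpoly.
have /eqP := cf_emb (P - Q) w; rewrite E cf0 eq_sym iota_eq0 => /eqP ->.
by rewrite coef0.
Qed.

Definition cst : {poly k} -> {poly A} := map_poly (in_alg A).
HB.instance Definition _ := GRing.RMorphism.on cst.

Lemma emb_cst c : emb (cst c) = (iota c)%:A.
Proof.
elim/poly_ind: c => [|c x IH]; first by rewrite !rmorph0 scale0r.
rewrite /cst !rmorphD !rmorphM /= map_polyX map_polyC /= embX embC IH.
rewrite cmapZ rmorph1 scalerDl; congr (_ + _).
by rewrite mulr_algl scalerA mulrC.
Qed.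

Lemma clear_denominators (p : B) : exists c P, c != 0 /\ iota c *: p = emb P.
Proof.
elim/freeAlg_ind: p => [|p q [c [P [c0 HP]]] [e [Q [e0 HQ]]]|x w].
- by exists 1, 0; rewrite oner_neq0 scaler0 rmorph0.
- exists (c * e), (cst e * P + cst c * Q); split; first by rewrite mulf_neq0.
  rewrite rmorphD !rmorphM /= !emb_cst !mulr_algl -HP -HQ !scalerA scalerDr.
  by rewrite [iota e * _]mulrC.
have [n [e [e0 ->]]] := iota_frac x; exists e, (cst n * (mon w)%:P); split=> //.
by rewrite rmorphM /= emb_cst embC cmap_mon mulr_algl scalerA mulrC divfK // iota_eq0.
Qed.

Lemma comm_alg (c : k) (a : A) : a * c%:A = c%:A * a.
Proof. by rewrite scaleAr mulr1 mulr_algl. Qed.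

Lemma comm_XsubC (c : k) (P : {poly A}) : ('X - (c%:A)%:P) * P = P * ('X - (c%:A)%:P).
Proof.
rewrite mulrBl mulrBr commr_polyX; congr (_ - _).
by apply/polyP => i; rewrite coefCM coefMC comm_alg.
Qed.

(* Gauss' lemma: remove the roots of [c] one by one; then [f - 'X] has degree one
   in ['X], so a factor of degree zero in ['X] is a unit. *)
Lemma factor_constant (c : {poly k}) (P Q : {poly A}) (f : A) : c != 0 ->
  P * Q = cst c * (f%:P - 'X) -> (deg (emb P) <= 1)%N \/ (deg (emb Q) <= 1)%N.
Proof.
have [n] := ubnP (size c); elim: n c P Q => // n IHn c P Q; rewrite ltnS => Hn c0 E.
case: (eqVneq (size c) 1%N) => [s1|].
  move/eqP: s1 => /size_poly1P[x x0 cE].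
  have {}E : P * Q = (x%:A)%:P * (f%:P - 'X) by rewrite E cE /cst map_polyC.
  have c1 : (P * Q)`_1 = - x%:A.
    by rewrite E coefCM coefB coefC coefX /= sub0r mulrN1.
  have xA0 : - x%:A != 0 :> A.
    by rewrite oppr_eq0 scaler_eq0 negb_or x0 oner_neq0.
  have dx : (deg (- x%:A : A) <= 1)%N by rewrite -scaleN1r; apply: degZ; apply: degZ; apply: deg1.
  have s2 : (size (P * Q)%R <= 2)%N.
    rewrite E mul_polyC; apply: leq_trans (size_scale_leq _ _) _.
    by rewrite -opprB size_polyN size_XsubC.
  have P0 : P != 0 by apply: contraNneq xA0 => P0; rewrite -c1 P0 mul0r coef0.
  have Q0 : Q != 0 by apply: contraNneq xA0 => Q0; rewrite -c1 Q0 mulr0 coef0.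
  have l0 : lead_coef P * lead_coef Q != 0.
    apply/negP => /eqP/freeAlg_mulf_eq0[] /eqP; rewrite lead_coef_eq0; [exact/negP | exact/negP].
  move: s2; rewrite size_proper_mul //.
  move: P0 Q0; rewrite -!size_poly_gt0 => P0 Q0 s2.
  have [sP|sQ] : size P = 1%N \/ size Q = 1%N by lia.
    left; move/eqP: sP => /size_poly1P[p _ PE]; rewrite PE embC; apply: leq_trans (deg_cmap _ _ _) _.
    move: c1; rewrite PE coefCM => c1.
    by have [] := @deg_factor_le1 _ _ _ p Q`_1; rewrite ?c1.
  right; move/eqP: sQ => /size_poly1P[q _ QE]; rewrite QE embC; apply: leq_trans (deg_cmap _ _ _) _.
  move: c1; rewrite QE coefMC => c1.
  by have [] := @deg_factor_le1 _ _ _ P`_1 q; rewrite ?c1.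
move=> /closed_rootP[r /factor_theorem[c' cE]].
have c'0 : c' != 0 by apply: contraNneq c0 => c'0; rewrite cE c'0 mul0r.
have sc' : (size c' < n)%N.
  by apply: leq_trans Hn; rewrite cE size_Mmonic ?monicXsubC // size_XsubC addn2.
pose z : A := r%:A; pose D : {poly A} := 'X - z%:P.
have cstE : cst c = cst c' * D by rewrite cE rmorphM /= /cst rmorphB /= map_polyX map_polyC.
have Dreg : GRing.rreg D by apply: monic_rreg; apply: monicXsubC.
have zcomm (S : {poly A}) : comm_poly S z by rewrite /comm_poly /z comm_alg.
have dD (S : {poly A}) : (deg (emb S) <= 1 -> deg (emb (S * D)) <= 1)%N.
  move=> dS; rewrite rmorphM rmorphB /= embX embC cmapZ rmorph1 -scalerBl scaleAr mulr1.
  exact: degZ.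
have E' : P * Q = cst c' * (f%:P - 'X) * D by rewrite E cstE -!mulrA comm_XsubC.
(* Evaluation at the central element [z] is multiplicative and [A] is a domain, so [D] divides one
   of the factors. *)
have : P.[z] * Q.[z] = 0.
  by rewrite -hornerM_comm // E' hornerM_comm // hornerXsubC subrr mulr0.
case/freeAlg_mulf_eq0 => /eqP/factor_theorem[S SE].
  have : S * Q = cst c' * (f%:P - 'X).
    by apply: Dreg; rewrite -E' SE -!mulrA comm_XsubC.
  by case/(IHn _ _ _ sc' c'0) => [/dD|]; [rewrite -SE; left | right].
have : P * S = cst c' * (f%:P - 'X) by apply: Dreg; rewrite -E' SE mulrA.
by case/(IHn _ _ _ sc' c'0) => [|/dD]; [left | rewrite -SE; right].
Qed.

(** The generic level [f - t], scaled to constant term [1] so that the restarting shift applies. *)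
Definition gen_level (f : A) : B := (phi (cf f [::]) - lam)^-1 *: (cmap f - lam%:A).

Lemma gen_unit (f : A) : phi (cf f [::]) - lam != 0.
Proof.
by rewrite /phi /= -rmorphB iota_eq0 -opprB oppr_eq0 polyXsubC_eq0.
Qed.

Lemma deg_gen_level (f : A) : deg (gen_level f) = deg (cmap f - lam%:A).
Proof. by rewrite deg_scale // invr_eq0 gen_unit. Qed.

Lemma gen_level_atom (f : A) : (1 < deg f)%N -> nonunit_atom (gen_level f).
Proof.
move=> df; split.
- move=> s q; have [n [e [e0 uE]]] := iota_frac (phi (cf f [::]) - lam)^-1.
  have n0 : n != 0.
    have := gen_unit f; rewrite -invr_eq0 uE; apply: contraNneq => ->.
    by rewrite rmorph0 mul0r.
  have [c1 [P [c10 HP]]] := clear_denominators s.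
  have [c2 [Q [c20 HQ]]] := clear_denominators q.
  move=> E; have : (cst e * P) * Q = cst (c1 * c2 * n) * (f%:P - 'X).
    have HT : cmap f - lam%:A = (iota e / iota n) *: (s * q).
      by rewrite -E /gen_level uE scalerA mulrA divfK ?divff ?scale1r ?iota_eq0.
    apply: emb_inj; rewrite !rmorphM rmorphB /= embX embC !emb_cst -HP -HQ HT.
    do 8!rewrite -?scalerAl ?scaleAr ?mul1r ?scalerA; congr (_ *: _).
    by field; rewrite iota_eq0.
  case/factor_constant; first by rewrite !mulf_neq0.
    rewrite rmorphM /= emb_cst mulr_algl -HP !deg_scale ?iota_eq0 //; by left.
  by rewrite -HQ deg_scale ?iota_eq0 //; right.
- rewrite deg_gen_level ltnNge; apply/negP => /deg_leP H; move: df; rewrite ltnNge => /negP[].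
  apply/deg_leP => w Hw; have := H w Hw; rewrite cfB cfZ cf1 cf_cmap.
  case: w Hw => // i w _; rewrite mulr0 subr0 => /eqP.
  by rewrite /phi /= iota_eq0 polyC_eq0 => /eqP.
by rewrite cfZ cfB cfZ cf1 mulr1 cf_cmap mulVf // gen_unit.
Qed.

(* Right evaluation at [g] of [(f - 'X) a = b (g - 'X)] gives [f r = r g] for
   [r = a.[g]]. *)
Lemma intertwiner_of_hom (f g : A) (a b : B) : a != 0 -> (deg a < deg (gen_level g))%N ->
  gen_level f * a = b * gen_level g -> exists r : A, r != 0 /\ f * r = r * g.
Proof.
move=> a0 da E; pose u := phi (cf f [::]) - lam; pose v := phi (cf g [::]) - lam.
have u0 : u != 0 := gen_unit f; have v0 : v != 0 := gen_unit g.
have {}E : (cmap f - lam%:A) * a = ((u / v) *: b) * (cmap g - lam%:A).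
  move: E; rewrite /gen_level -/u -/v -!scalerAl scaleAr => /(congr1 (fun x => u *: x)).
  by rewrite !scalerA mulfV // scale1r.
have [c1 [P [c10 HP]]] := clear_denominators a.
have [c2 [Q [c20 HQ]]] := clear_denominators ((u / v) *: b).
pose P' := cst c2 * P.
have P'E : emb P' = iota (c1 * c2) *: a.
  by rewrite /P' [LHS]rmorphM /= emb_cst mulr_algl -HP scalerA -rmorphM mulrC.
have {}E : (f%:P - 'X) * P' = (cst c1 * Q) * (g%:P - 'X).
  apply: emb_inj; rewrite rmorphM /= P'E !rmorphM !rmorphB /= !embX !embC emb_cst.
  by rewrite scaleAr E mulr_algl -HQ -!scalerAl scalerA.
exists P'.[g]; split; last first.
  have /eqP : ((cst c1 * Q) * (g%:P - 'X)).[g] = 0.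
    rewrite -opprB mulrN hornerN; apply/eqP; rewrite oppr_eq0; apply/factor_theorem.
    by exists (cst c1 * Q).
  (* Evaluation keeps coefficients to the left of the powers of [g]; moving ['X] to the right of
     [P'] first is what puts [g] to the right of [P'.[g]]. *)
  rewrite -E mulrBl hornerD hornerN hornerCM -commr_polyX hornerMX subr_eq0.
  by move/eqP.
(* A root at [g] would make a scalar multiple of [a] a left multiple of [gen_level g], hence of at
   least its degree, against [da]. *)
apply/negP => /factor_theorem[S SE].
have : emb P' = (- v *: emb S) * gen_level g.
  rewrite SE rmorphM rmorphB /= embX embC /gen_level -/v -scalerAl scaleAr scalerA.
  by rewrite mulNr mulfV // scaleN1r -mulrN opprB.
rewrite P'E => Ea; move: da; rewrite ltnNge => /negP[].
have cc : iota (c1 * c2) != 0 by rewrite iota_eq0 mulf_neq0.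
rewrite -(deg_scale a cc) Ea; apply: deg_factor_ge.
by rewrite -Ea scaler_eq0 negb_or cc.
Qed.

End FunctionField.

(** * Points where a polynomial is invertible *)

Section CyclicShift.
Variables (k : closedFieldType) (d : nat) (A : freeAlg k d).
Hypothesis chark0 : [pchar k] =i pred0.
Implicit Types (u v w : seq 'I_d).

Lemma poly_nonroot (p : {poly k}) : p != 0 -> exists x, p.[x] != 0.
Proof. by move=> /closed_nonrootP[x]; exists x. Qed.

Section Shift.
Variables (R : comNzRingType) (N : nat) (y : 'I_d -> 'I_N.+1 -> R).

Fixpoint path_weight u (j : 'I_N.+1) : R :=
  if u is i :: v then y i j * path_weight v (ordS j) else 1.

Definition shift_mx (i : 'I_d) : 'M[R]_N.+1 := \matrix_(j, l) (y i j *+ (l == ordS j)).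

Lemma shift_mxE u j l :
  (\prod_(i <- u) shift_mx i) j l = path_weight u j *+ (l == iter (size u) (@ordS _) j).
Proof.
elim: u j => [|i u IHu] j; first by rewrite big_nil !mxE eq_sym.
rewrite big_cons mxE (bigD1 (ordS j)) //= [X in _ + X]big1 => [|t ne].
  by rewrite addr0 mxE eqxx IHu -iterSr mulrnAr.
by rewrite mxE (negbTE ne) mul0r.
Qed.

End Shift.

Lemma iter_ordS N (c : 'I_N.+1) l : iter l (@ordS _) c = ((c + l) %% N.+1)%N :> nat.
Proof.
elim: l => [|l IHl] /=; first by rewrite addn0 modn_small.
by rewrite IHl -addn1 modnDml addn1 addnS.
Qed.

Lemma natr_inj_char0 : injective (fun n : nat => n%:R : k).
Proof.
move=> m n E; apply/eqP; move: m n E; suff H m n : (m <= n)%N -> m%:R = n%:R :> k -> m == n.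
  move=> m n E; case: (leqP m n) => [/H|/ltnW/H]; first exact.
  by rewrite eq_sym; apply.
move=> le /eqP; rewrite eq_sym -subr_eq0 -natrB // ((pcharf0P k).1 chark0) subn_eq0.
by rewrite eqn_leq le => ->.
Qed.

(* Lagrange interpolation: at the parameter [c], the path of the word [w] that
   starts at [c] is the only one of its length with a nonzero weight. *)
Lemma generic_weights N w : (size w <= N.+1)%N ->
  exists y : 'I_d -> 'I_N.+1 -> {poly k}, forall c : 'I_N.+1,
    exists2 x : k, x != 0 & forall u, size u = size w ->
      (path_weight y u c).[c%:R] = x *+ (u == w).
Proof.
move=> sw; pose ell (c : 'I_N.+1) : {poly k} := \prod_(c' < N.+1 | c' != c) ('X - ((c' : nat)%:R)%:P).
have ell_eq c : (ell c).[c%:R] != 0.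
  rewrite horner_prod; apply/prodf_neq0 => c' ne; rewrite hornerXsubC subr_eq0.
  by apply: contraNneq ne => /natr_inj_char0/val_inj ->.
have ell_ne c c' : c' != c -> (ell c).[c'%:R] = 0.
  by move=> ne; rewrite horner_prod (bigD1 c') //= hornerXsubC subrr mul0r.
(* [j + (N.+1 - c)] modulo [N.+1] is the distance from [c] to [j] around the cycle: at parameter
   [c], letter [i] has weight only where [w] reads [i]. [None] marks positions past the end of
   [w]. *)
pose y (i : 'I_d) (j : 'I_N.+1) : {poly k} :=
  \sum_(c < N.+1) ell c *+ (nth None (map Some w) ((j + (N.+1 - c)) %% N.+1)%N == Some i).
have yE i (c : 'I_N.+1) l : (l < N.+1)%N ->
    (y i (iter l (@ordS _) c)).[c%:R] = (ell c).[c%:R] *+ (nth None (map Some w) l == Some i).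
  move=> ltl; rewrite horner_sum (bigD1 c) //= big1 => [|c' ne]; last first.
    by rewrite hornerMn ell_ne ?mul0rn // eq_sym.
  rewrite addr0 hornerMn iter_ordS modnDml.
  have -> : ((c + l + (N.+1 - c)) = l + N.+1)%N by have := ltn_ord c; lia.
  by rewrite modnDr modn_small.
exists y => c; exists ((ell c).[c%:R] ^+ size w); first by rewrite expf_neq0.
have key u w1 w2 : w1 ++ w2 = w -> size u = size w2 ->
    (path_weight y u (iter (size w1) (@ordS _) c)).[c%:R] = (ell c).[c%:R] ^+ size u *+ (u == w2).
  elim: u w1 w2 => [|i u IHu] w1 [|i' w2] //= wE; first by rewrite hornerC.
  move=> [su]; rewrite hornerM yE; last first.
    by apply: leq_trans sw; rewrite -wE size_cat /= addnS ltnS leq_addr.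
  have := IHu (rcons w1 i') w2; rewrite cat_rcons size_rcons iterS => -> //.
  rewrite -wE map_cat nth_cat size_map ltnn subnn /= eqseq_cons exprS.
  rewrite -[Some i' == _]/(i' == i) eq_sym; case: (i == i') => /=.
    by rewrite mulr1n mulrnAr.
  by rewrite !mulr0n mul0r.
by move=> u su; rewrite -su; apply: (key u [::] w).
Qed.

Lemma lowest_word (a : A) : a != 0 ->
  exists2 w, cf a w != 0 & forall u, (size u < size w)%N -> cf a u = 0.
Proof.
move=> /deg_lead[w _]; have [n] := ubnP (size w); elim: n w => // n IHn w; rewrite ltnS => Hn w0.
case: (classic (exists2 u, (size u < size w)%N & cf a u != 0)) => [[u Hu u0]|no].
  by apply: (IHn u) => //; apply: leq_trans Hu Hn.
exists w => // u Hu; apply/eqP/negP => /negP u0; apply: no; by exists u.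
Qed.

(* For a cyclic weighted shift, the lowest homogeneous part of [a] is a monomial
   matrix. *)
Lemma generic_invertible (a : A) : a != 0 -> exists n0, forall N, (n0 <= N)%N ->
  exists Y : {ffun 'I_d -> 'M[k]_N.+1}, \det (ev Y a) != 0.
Proof.
move=> /lowest_word[w w0 wmin]; exists (size w) => N leN; pose m := size w.
have [y Hy] := @generic_weights N w (leqW leN).
pose p (c : 'I_N.+1) : {poly k} := \sum_(u <- words d m.+1 | size u == m) (cf a u)%:P * path_weight y u c.
have p0 c : p c != 0.
  have [x x0 Hx] := Hy c; have : (p c).[c%:R] != 0.
    rewrite horner_sum big_mkcond (bigD1_seq w) ?words_uniq ?mem_words //=.
    rewrite hornerM hornerC Hx // !eqxx big1 ?addr0 ?mulf_neq0 // => u ne.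
    by case: eqP => // su; rewrite hornerM Hx // (negbTE ne) mulr0.
  by apply: contraNneq => ->; rewrite horner0.
have [t Ht] : exists t, (\prod_c p c).[t] != 0 by apply: poly_nonroot; apply/prodf_neq0.
pose z i j : k := (y i j).[t].
have zE u j : path_weight z u j = (path_weight y u j).[t].
  by elim: u j => [|i u IHu] j /=; rewrite ?hornerC // hornerM IHu.
pose mono u : 'M[k]_N.+1 := \prod_(i <- u) shift_mx z i.
(* The value of [a] at the shift scaled by [s], divided by [s ^ m]. Truncated subtraction is safe
   because words shorter than [m] have coefficient zero in [a]. *)
pose C : 'M[{poly k}]_N.+1 :=
  \sum_(u <- words d (deg a)) (cf a u *: 'X^(size u - m)) *: map_mx polyC (mono u).
have CE s : map_mx (horner_eval s) C =
    \sum_(u <- words d (deg a)) (cf a u * s ^+ (size u - m)) *: mono u.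
  rewrite raddf_sum; apply: eq_bigr => u _; apply/matrixP => i j.
  by rewrite !mxE /= /horner_eval hornerM hornerZ hornerXn hornerC.
have C0 : \det (map_mx (horner_eval 0) C) != 0.
  have E0 i j : (map_mx (horner_eval 0) C) i j = (p i).[t] *+ (j == iter m (@ordS _) i).
    have cz u : (deg a <= size u)%N -> (cf a u * 0 ^+ (size u - m)) * mono u i j = 0.
      by move=> /cf_deg ->; rewrite !mul0r.
    rewrite CE summxE; under eq_bigr => u _ do rewrite mxE.
    rewrite -(big_words_widen (leq_maxl _ m.+1) cz) horner_sum -sumrMnl.
    have lem : (m.+1 <= maxn (deg a) m.+1)%N by apply: leq_maxr.
    rewrite [RHS]big_mkcond -[RHS](big_words_widen lem); last first.
      by move=> u Hu; case: eqP => // E; rewrite E ltnn in Hu.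
    apply: eq_bigr => u _; rewrite shift_mxE.
    case: (ltngtP (size u) m) => [lt|lt|->].
    - by rewrite wmin // !mul0r.
    - by rewrite expr0n subn_eq0 leqNgt lt mulr0 mul0r.
    by rewrite subnn expr0 mulr1 hornerM hornerC zE mulrnAr.
  apply/negP => /det0P[v v0 /matrixP Hv]; case/negP: v0; apply/eqP/matrixP => i j.
  have := Hv i (iter m (@ordS _) j); rewrite ord1 mxE (bigD1 j) //= E0 eqxx big1 => [|l ne].
    rewrite addr0 !mxE => /eqP; rewrite mulf_eq0 => /orP[/eqP -> //|/eqP pj0].
    by move: Ht; rewrite mulr1n in pj0; rewrite horner_prod (bigD1 j) //= pj0 mul0r eqxx.
  rewrite E0; case: eqP => [E|]; last by rewrite mulr0.
  case/negP: ne; apply/eqP; move: E; clear; elim: m => //= m IHm E; symmetry.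
  by apply/esym/IHm; apply: (can_inj (@ordSK _)).
(* The factor ['X] makes [s] nonzero, so multiplying back by [s ^ m] keeps the determinant
   nonzero. *)
have [s Hs] : exists s, ('X * \det C).[s] != 0.
  apply: poly_nonroot; rewrite mulf_neq0 ?polyX_eq0 //.
  by apply: contraNneq C0 => E; rewrite det_map_mx E rmorph0.
move: Hs; rewrite hornerM hornerX mulf_eq0 negb_or => /andP[s0 Hs].
exists [ffun i => s *: shift_mx z i].
have -> : ev [ffun i => s *: shift_mx z i] a = s ^+ m *: map_mx (horner_eval s) C.
  rewrite CE scaler_sumr; apply: eq_bigr => u _.
  have -> : \prod_(i <- u) [ffun i => s *: shift_mx z i] i = s ^+ size u *: mono u.
    elim: u => [|i u IHu]; first by rewrite /mono !big_nil expr0 scale1r.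
    by rewrite /mono !big_cons IHu ffunE -scalerAl -scalerAr scalerA -exprS.
  rewrite !scalerA; case: (ltnP (size u) m) => [lt|le]; first by rewrite wmin // !(mul0r, mulr0).
  by rewrite mulrCA -exprD subnKC.
rewrite detZ mulf_neq0 ?expf_neq0 //.
by rewrite det_map_mx.
Qed.

End CyclicShift.

(** * Specialization *)

Section Specialization.
Variables (k : closedFieldType) (K : fieldType) (iota : {rmorphism {poly k} -> K}).
Hypothesis iota_inj : injective iota.
Hypothesis iota_frac : forall x : K, exists n d : {poly k}, d != 0 /\ x = iota n / iota d.
Variables (d : nat) (A : freeAlg k d) (B : freeAlg K d).

Let iota_eq0 c : (iota c == 0) = (c == 0).
Proof. by rewrite -(rmorph0 iota) (inj_eq iota_inj). Qed.

Local Notation lam := (iota 'X).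
Local Notation phi := (phi iota).
Local Notation cmap := (@cmap k K phi d A B).

(* [x] is defined at [r], with value [y]. *)
Definition spec (r : k) (x : K) (y : k) : Prop :=
  exists n e : {poly k}, [/\ e.[r] != 0, x = iota n / iota e & y = n.[r] / e.[r]].

Let denom_neq0 (e : {poly k}) r : e.[r] != 0 -> iota e != 0.
Proof. by rewrite iota_eq0; apply: contraNneq => ->; rewrite horner0. Qed.

Lemma spec_iota r p : spec r (iota p) p.[r].
Proof. by exists p, 1; rewrite hornerC oner_neq0 rmorph1 !divr1. Qed.

Lemma spec_phi r c : spec r (phi c) c.
Proof. by have := spec_iota r c%:P; rewrite hornerC. Qed.

Lemma specD r x y x' y' : spec r x y -> spec r x' y' -> spec r (x + x') (y + y').
Proof.
move=> [n [e [e0 -> ->]]] [n' [e' [e'0 -> ->]]].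
exists (n * e' + n' * e), (e * e'); rewrite hornerD !hornerM !rmorphD !rmorphM /=.
by split; rewrite ?mulf_neq0 // addf_div ?(denom_neq0 e0) ?(denom_neq0 e'0).
Qed.

Lemma specM r x y x' y' : spec r x y -> spec r x' y' -> spec r (x * x') (y * y').
Proof.
move=> [n [e [e0 -> ->]]] [n' [e' [e'0 -> ->]]].
by exists (n * n'), (e * e'); rewrite !hornerM !rmorphM /= !mulf_div mulf_neq0.
Qed.

Lemma specN r x y : spec r x y -> spec r (- x) (- y).
Proof.
by move=> [n [e [e0 -> ->]]]; exists (- n), e; rewrite hornerN rmorphN /= !mulNr.
Qed.

Lemma spec0 r y : spec r 0 y -> y = 0.
Proof.
move=> [n [e [e0 E ->]]]; have /eqP := esym E.
rewrite mulf_eq0 invr_eq0 (negbTE (denom_neq0 e0)) orbF iota_eq0 => /eqP ->.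
by rewrite horner0 mul0r.
Qed.

Lemma spec_inj r x y y' : spec r x y -> spec r x y' -> y = y'.
Proof.
move=> H H'; apply/eqP; rewrite -subr_eq0; apply/eqP/(@spec0 r).
by rewrite -(subrr x); apply: specD => //; apply: specN.
Qed.

Lemma spec_sum r I (s : seq I) (P : pred I) (h : I -> K) (h' : I -> k) :
  (forall i, spec r (h i) (h' i)) ->
  spec r (\sum_(i <- s | P i) h i) (\sum_(i <- s | P i) h' i).
Proof.
move=> H; elim/big_rec2: _ => [|i y x _]; first by have := spec_iota r 0; rewrite rmorph0 horner0.
exact: specD.
Qed.

Lemma spec_prod r I (s : seq I) (P : pred I) (h : I -> K) (h' : I -> k) :
  (forall i, spec r (h i) (h' i)) ->
  spec r (\prod_(i <- s | P i) h i) (\prod_(i <- s | P i) h' i).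
Proof.
move=> H; elim/big_rec2: _ => [|i y x _]; first by have := spec_iota r 1; rewrite rmorph1 hornerC.
exact: specM.
Qed.

Definition spec_mx r n (M : 'M[K]_n) (M' : 'M[k]_n) := forall i j, spec r (M i j) (M' i j).

Lemma spec_det r n (M : 'M[K]_n) (M' : 'M[k]_n) : spec_mx r M M' -> spec r (\det M) (\det M').
Proof.
move=> H; apply: spec_sum => s; apply: specM; last by apply: spec_prod.
have := spec_iota r ((-1)%:P ^+ perm.odd_perm s).
by rewrite horner_exp hornerC rmorphXn /= polyCN rmorphN1.
Qed.

Lemma spec_ev r n (X : {ffun 'I_d -> 'M[K]_n.+1}) (X' : {ffun 'I_d -> 'M[k]_n.+1}) (p : A) :
  (forall i, spec_mx r (X i) (X' i)) -> spec_mx r (ev X (cmap p)) (ev X' p).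
Proof.
move=> H; elim/freeAlg_ind: p => [|p q Hp Hq|c w] i j.
- by rewrite !raddf0 !mxE; have := spec_iota r 0; rewrite rmorph0 horner0.
- by rewrite !raddfD !mxE; apply: specD.
rewrite cmapZ cmap_mon !linearZ /= !ev_mon !mxE; apply: specM; first exact: spec_phi.
elim: w i j => [|l w IHw] i j.
  by rewrite !big_nil !mxE; case: (i == j); [have := spec_iota r 1; rewrite rmorph1 hornerC |
    have := spec_iota r 0; rewrite rmorph0 horner0].
by rewrite !big_cons !mxE; apply: spec_sum => t; apply: specM; [apply: H | apply: IHw].
Qed.

(** It suffices that [r] avoid the zeros of the denominators of the entries of [X] and of the
    numerator of the determinant for [f]. *)
Lemma specialize_point (f g : A) n (X : {ffun 'I_d -> 'M[K]_n.+1}) :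
  \det (ev X (gen_level iota B g)) = 0 -> \det (ev X (gen_level iota B f)) != 0 ->
  exists r (X' : {ffun 'I_d -> 'M[k]_n.+1}),
    \det (ev X' (g - r%:A)) = 0 /\ \det (ev X' (f - r%:A)) != 0.
Proof.
rewrite /gen_level ![ev X (_ *: _)]linearZ /= !detZ => /eqP.
rewrite mulf_eq0 expf_eq0 invr_eq0 (negbTE (gen_unit iota_inj g)) andbF /= => /eqP dg.
rewrite mulf_eq0 negb_or => /andP[_ df].
have [nm Hnm] := fin_all_exists (fun i => fin_all_exists (fun j => fin_all_exists (fun l => iota_frac (X i j l)))).
have {Hnm}[e He] := fin_all_exists (fun i => fin_all_exists (fun j => fin_all_exists (Hnm i j))).
have [a [b [b0 dfE]]] := iota_frac (\det (ev X (cmap f - lam%:A))).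
have a0 : a != 0.
  by apply: contraNneq df => a0; rewrite dfE a0 rmorph0 mul0r.
have [r] : exists r, (a * \prod_i \prod_j \prod_l e i j l).[r] != 0.
  apply: poly_nonroot; rewrite mulf_neq0 //; apply/prodf_neq0 => i _.
  by apply/prodf_neq0 => j _; apply/prodf_neq0 => l _; case: (He i j l).
rewrite hornerM mulf_eq0 negb_or => /andP[ar er].
have {}er i j l : (e i j l).[r] != 0.
  apply: contraNneq er => e0; rewrite horner_prod (bigD1 i) //= horner_prod (bigD1 j) //=.
  by rewrite horner_prod (bigD1 l) //= e0 !mul0r.
pose X' : {ffun 'I_d -> 'M[k]_n.+1} := [ffun i => \matrix_(j, l) ((nm i j l).[r] / (e i j l).[r])].
have HX i : spec_mx r (X i) (X' i).
  by move=> j l; rewrite ffunE mxE; have [_ ->] := He i j l; exists (nm i j l), (e i j l).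
have Hev h : spec r (\det (ev X (cmap h - lam%:A))) (\det (ev X' (h - r%:A))).
  apply: spec_det => i j; rewrite ![ev _ (_ - _)]linearB /= ![ev _ (_ *: 1)]linearZ /= !ev1 !mxE.
  apply: specD; first exact: spec_ev.
  apply: specN; apply: specM; first by have := spec_iota r 'X; rewrite hornerX.
  by case: (i == j); [have := spec_iota r 1; rewrite rmorph1 hornerC |
    have := spec_iota r 0; rewrite rmorph0 horner0].
exists r, X'; split; first by apply: (@spec0 r); rewrite -dg.
apply: contraNneq ar => f0; have [n1 [e1 [e10 E1 E2]]] := Hev f.
move: E2; rewrite f0 => /esym/eqP; rewrite mulf_eq0 invr_eq0 (negbTE e10) orbF => /eqP n1r.
(* [b] may vanish at [r], so the two fractions for the determinant are compared by
   cross-multiplication before evaluating. *)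
have : a * e1 = n1 * b.
  apply: iota_inj; rewrite !rmorphM /=; apply/eqP; rewrite -eqr_div ?(denom_neq0 e10) ?iota_eq0 //.
  by rewrite -dfE -E1.
move=> /(congr1 (horner^~ r)); rewrite /= !hornerM n1r mul0r => /eqP.
by rewrite mulf_eq0 (negbTE e10) orbF => /eqP ->.
Qed.

(** Enlarges a point to a size at which [generic_invertible] applies, without changing which
    determinants vanish. *)
Lemma direct_power n (X : {ffun 'I_d -> 'M[k]_n.+1}) m :
  exists N (X' : {ffun 'I_d -> 'M[k]_N.+1}), (m <= N)%N /\
    forall p : A, \det (ev X' p) = \det (ev X p) ^+ m.+1.
Proof.
elim: m => [|m [N [X' [leN HX]]]]; first by exists n, X; split=> // p; rewrite expr1.
exists (n + N.+1)%N, [ffun i => block_mx (X i) 0 0 (X' i) : 'M[k]_(n.+1 + N.+1)].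
split=> [|p]; first by rewrite addnS ltnS (leq_trans leN) // leq_addl.
set Y := finfun _.
suff -> : ev Y p = block_mx (ev X p) 0 0 (ev X' p) :> 'M[k]_(n.+1 + N.+1).
  by rewrite -[LHS]/(@determinant k (n.+1 + N.+1) (block_mx _ _ _ _)) det_ublock HX [RHS]exprS.
elim/freeAlg_ind: p => [|p q Hp Hq|c w].
- by rewrite !linear0 block_mx0.
- rewrite !linearD /= Hp Hq; apply: etrans (add_block_mx _ _ _ _ _ _ _ _) _.
  by rewrite !addr0.
rewrite !linearZ /= !ev_mon.
transitivity (c *: (block_mx (\prod_(i <- w) X i) 0 0 (\prod_(i <- w) X' i) : 'M_(n.+1 + N.+1))).
  congr (_ *: _); elim: w => [|i w IHw]; first by rewrite !big_nil -[RHS]scalar_mx_block.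
  have := mulmx_block (X i) 0 0 (X' i) (\prod_(i <- w) X i) 0 0 (\prod_(i <- w) X' i).
  rewrite !mulmx0 !mul0mx !addr0 !add0r => E.
  by rewrite !big_cons IHw ffunE; exact: E.
by rewrite scale_block_mx !scaler0.
Qed.

(* Move along the line from [X] to a point where [a] is invertible: the levels
   of [f] and [g] agree at its generic point, hence at [X]. *)
Lemma intertwined_levels (chark0 : [pchar k] =i pred0) (f g a : A) r n
  (X : {ffun 'I_d -> 'M[k]_n.+1}) : a != 0 -> f * a = a * g ->
  (\det (ev X (f - r%:A)) == 0) = (\det (ev X (g - r%:A)) == 0).
Proof.
move=> a0 E; have [m Hm] := generic_invertible chark0 a0.
have [N [X' [leN HX]]] := direct_power X m; have [Y HY] := Hm N leN.
suff Edet : \det (ev X' (f - r%:A)) = \det (ev X' (g - r%:A)).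
  by move: Edet; rewrite !HX => /(congr1 (fun x => x == 0)); rewrite !expf_eq0.
pose Z : {ffun 'I_d -> 'M[K]_N.+1} :=
  [ffun i => map_mx phi (X' i) + lam *: map_mx phi (Y i - X' i)].
have HZ s (W : {ffun 'I_d -> 'M[k]_N.+1}) : (forall i, W i = X' i + s *: (Y i - X' i)) ->
    forall p : A, spec s (\det (ev Z (cmap p))) (\det (ev W p)).
  move=> WE p; apply: spec_det; apply: spec_ev => i j l.
  rewrite WE ffunE !mxE; apply: specD; first exact: spec_phi.
  by apply: specM; [have := spec_iota s 'X; rewrite hornerX | exact: spec_phi].
have HZ0 p : spec 0 (\det (ev Z (cmap p))) (\det (ev X' p)).
  by apply: HZ => i; rewrite scale0r addr0.
have HZ1 p : spec 1 (\det (ev Z (cmap p))) (\det (ev Y p)).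
  by apply: HZ => i; rewrite scale1r addrC subrK.
have da : \det (ev Z (cmap a)) != 0.
  by apply: contraNneq HY => d0; apply/eqP/(@spec0 1); rewrite -d0.
have Er : (f - r%:A) * a = a * (g - r%:A).
  by rewrite mulrBl mulrBr E mulr_algl scaleAr mulr1.
apply: (spec_inj (HZ0 _)); suff -> : \det (ev Z (cmap (f - r%:A))) = \det (ev Z (cmap (g - r%:A))) by [].
apply: (mulfI da); rewrite mulrC -!det_mulmx.
by rewrite -[_ *m _]/(_ * _) -[X in _ = \det X]/(_ * _) -!evM -!rmorphM /= Er.
Qed.

Lemma intertwiner_of_levels (f g : A) :
  (forall n (X : {ffun 'I_d -> 'M[k]_n.+1}) r,
    (\det (ev X (f - r%:A)) == 0) = (\det (ev X (g - r%:A)) == 0)) ->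
  exists a : A, a != 0 /\ f * a = a * g.
Proof.
have cf_gen (h : A) : cf (gen_level iota B h) [::] = 1.
  by rewrite cfZ cfB cfZ cf1 mulr1 cf_cmap mulVf // gen_unit.
have deg_gen (h : A) : (0 < deg (gen_level iota B h))%N.
  rewrite lt0n deg_eq0; apply/eqP => E; have := cf_gen h; rewrite E cf0 => /eqP.
  by rewrite eq_sym oner_eq0.
have sep (f' g' : A) s : (1 < deg g')%N ->
    kills (gen_level iota B f') s -> act (gen_level iota B g') 1 s = 1 ->
    exists n (X : {ffun 'I_d -> 'M[k]_n.+1}) r,
      (\det (ev X (f' - r%:A)) == 0) != (\det (ev X (g' - r%:A)) == 0).
  move=> dg Ks Hs.
  have atg := gen_level_atom iota_inj iota_frac B dg.
  have [N [X [Xg Xf]]] := separating_point (cf_gen f') atg (deg_gen f') Ks Hs.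
  have [r [X' [X'g X'f]]] := specialize_point Xg Xf.
  by exists N, X', r; rewrite X'g eqxx (negbTE X'f).
(* For constant [f'] the generic level is [1] and every letter kills the vector [1], so any [s]
   without constant term that fixes [1] for [g'] separates. *)
have sep_const (f' g' : A) : (deg f' <= 1)%N -> (1 < deg g')%N ->
    exists n (X : {ffun 'I_d -> 'M[k]_n.+1}) r,
      (\det (ev X (f' - r%:A)) == 0) != (\det (ev X (g' - r%:A)) == 0).
  move=> df dg; have [_ dG G1] := gen_level_atom iota_inj iota_frac B dg.
  have [s s0 Hs] := augmentation_generates dG G1.
  have fE : gen_level iota B f' = 1.
    rewrite /gen_level {2}(deg_le1 df) cmapZ rmorph1 -scalerBl scalerA mulVf ?scale1r //.
    exact: gen_unit.
  apply: (sep f' g' s) => //; rewrite fE => r.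
  rewrite (ld_expand (r * s)) cfM_nil s0 mulr0 scale0r add0r act_sum_s big1 // => i _.
  by rewrite actM act_x rs1 -mon_nil -[mon [::]]scale1r mon_nil ldC oppr0 act0p.
move=> H; case: (leqP (deg f) 1) => [df|df]; case: (leqP (deg g) 1) => [dg|dg].
- exists 1; rewrite oner_neq0 mulr1 mul1r; split=> //.
  have := H 0%N [ffun=> 0] (cf f [::]).
  rewrite {1}(deg_le1 df) {1}(deg_le1 dg) subrr linear0 det0 eqxx -scalerBl linearZ /= ev1.
  rewrite detZ det1 mulr1 expf_eq0 /= subr_eq0 => /esym/eqP E.
  by rewrite (deg_le1 df) (deg_le1 dg) E.
- by have [n [X [r]]] := sep_const f g df dg; rewrite H eqxx.
- by have [n [X [r]]] := sep_const g f dg df; rewrite H eqxx.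
have atf := gen_level_atom iota_inj iota_frac B df.
have atg := gen_level_atom iota_inj iota_frac B dg.
case: (separate_or_hom atf atg) => [[s [Ks Hs]]|[a [a0 da Ha]]].
  by have [n [X [r]]] := sep f g s dg Ks Hs; rewrite H eqxx.
have [b Hb] := hom_relation (cf_gen f) (cf_gen g) Ha.
exact: (intertwiner_of_hom iota_inj iota_frac a0 da Hb).
Qed.

End Specialization.

(** * The algebra of noncommutative polynomials *)

Section MalgInstance.
Variables (F : fieldType) (d : nat).
Local Notation A := (free_alg F d).

Definition malg_cf (p : A) (w : seq 'I_d) : F := p@_(FMonom w).
Definition malg_mon (w : seq 'I_d) : A := << FMonom w >>.

Lemma malg_cfD p q w : malg_cf (p + q) w = malg_cf p w + malg_cf q w.
Proof. exact: mcoeffD. Qed.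

Lemma malg_cfZ c p w : malg_cf (c *: p) w = c * malg_cf p w.
Proof. exact: mcoeffZ. Qed.

Lemma malg_cf_mon u w : malg_cf (malg_mon u) w = (u == w)%:R.
Proof. by rewrite /malg_cf /malg_mon mcoeffU1 fmP. Qed.

Lemma malg_mon_nil : malg_mon [::] = 1.
Proof. by apply/malgP => -[w]; rewrite mcoeff1 /malg_mon mcoeffU1 !fmP fm1 eq_sym. Qed.

Lemma malg_monM u v : malg_mon u * malg_mon v = malg_mon (u ++ v).
Proof.
rewrite malgM_def fgmulUU mulr1 /malg_mon; congr << _ >>.
by apply/eqP; rewrite fmP fmM.
Qed.

Lemma malg_scaleAr (c : F) (p q : A) : p * (c *: q) = c *: (p * q).
Proof.
have mulCr (r : A) : r * c%:MP = c *: r.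
  rewrite malgM_def fgmulgU -[c *: r]mul_malgC [RHS]malgM_def fgmulUg.
  by apply: eq_bigr => w _; rewrite mulm1 mul1m mulrC.
by rewrite -[c *: q]mul_malgC mulrA mulCr scalerAl.
Qed.

Lemma malg_expand_ex (p : A) :
  exists n, p == \sum_(w <- words d n) malg_cf p w *: malg_mon w.
Proof.
pose n := @mmeasure _ _ (@fdeg _) p; exists n.
apply/eqP/malgP => -[u]; rewrite raddf_sum /=.
have cfu w : mcoeff (FMonom u) (malg_cf p w *: malg_mon w) = malg_cf p w * (w == u)%:R.
  by rewrite mcoeffZ -[_@__]/(malg_cf _ _) malg_cf_mon.
under eq_bigr => w _ do rewrite cfu.
case: (ltnP (size u) n) => Hu.
  rewrite (bigD1_seq u) ?mem_words ?words_uniq //= eqxx mulr1 big1 ?addr0 // => w ne.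
  by rewrite (negbTE ne) mulr0.
rewrite big1_seq => [|w]; last first.
  by rewrite mem_words => /= Hw; case: eqP => [E|]; rewrite ?mulr0 //; rewrite E ltnNge Hu in Hw.
by apply: mcoeff_outdom; apply: (@mmeasure_mnm_ge _ _ (@fdeg _)); exact: Hu.
Qed.

Definition malg_freeAlg : freeAlg F d :=
  FreeAlg malg_cfD malg_cfZ malg_cf_mon malg_mon_nil malg_monM malg_scaleAr malg_expand_ex.

Lemma nc_evalE n (X : {ffun 'I_d -> 'M[F]_n.+1}) (p : A) :
  nc_eval X p = ev (A := malg_freeAlg) X p.
Proof.
elim/(@freeAlg_ind _ _ malg_freeAlg): p => [|p q Hp Hq|c w].
- by rewrite linear0 /nc_eval raddf0.
- by rewrite linearD /= -Hp -Hq /nc_eval raddfD.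
rewrite linearZ /= (@ev_mon _ _ malg_freeAlg).
have -> : c *: malg_mon w = << c *g FMonom w >>.
  by apply/malgP => u; rewrite mcoeffZ mcoeffU1 mcoeffU mulr_natr.
by rewrite /nc_eval mmapU -[LHS]/(_ *m _) mul_scalar_mx.
Qed.

Lemma eigenlevelE (lam : F) (p : A) (X : mx_point F d) :
  (X \in eigenlevel lam p) =
  (\det (ev (A := malg_freeAlg) (projT2 X) (p - lam%:A)) == 0).
Proof.
rewrite -[LHS]/(eigenvalue _ lam) nc_evalE linearB linearZ /= ev1.
apply/eigenvalueP/det0P => -[v Hv v0].
  exists v => //; rewrite mulmxBr Hv -scalemxAr -[v *m 1]/(v *m 1%:M) mulmx1 subrr //.
exists v => //; apply/eqP; rewrite -subr_eq0 -v0 mulmxBr -scalemxAr.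
by rewrite -[v *m 1]/(v *m 1%:M) mulmx1.
Qed.

End MalgInstance.

Lemma fraction_quot (R : idomainType) (x : {fraction R}) :
  exists n e : R, e != 0 /\ x = FracField.tofrac n / FracField.tofrac e.
Proof.
elim/quotW: x => r; exists (frac r).1, (frac r).2; split; first exact: denom_ratioP.
unlock FracField.tofrac; rewrite -[X in _ = _ * X]FracField.pi_inv -[RHS]FracField.pi_mul.
rewrite /FracField.mulf /FracField.invf !numden_Ratio ?oner_eq0 ?denom_ratioP // mulr1 mul1r.
by rewrite Ratio_numden.
Qed.

Theorem corollary4p4 (k : closedFieldType) (chark0 : [pchar k] =i pred0)
    (d : nat) (d_gt0 : (0 < d)%N) (f g : free_alg k d) :
  (forall lam : k, eigenlevel lam f =i eigenlevel lam g) <->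
  (exists a : free_alg k d, a != 0 /\ f * a = a * g).
Proof.
pose K := {fraction {poly k}}; pose iota : {rmorphism {poly k} -> K} := @FracField.tofrac {poly k}.
have iota_inj : injective iota by move=> p q /eqP; rewrite tofrac_eq => /eqP.
have iota_frac := @fraction_quot {poly k}.
split=> [H|[a [a0 E]] lam X].
  apply: (@intertwiner_of_levels _ _ iota iota_inj iota_frac d (malg_freeAlg k d) (malg_freeAlg K d)).
  by move=> n X r; have := H r (existT _ n X); rewrite !eigenlevelE.
rewrite !eigenlevelE.
exact: (@intertwined_levels _ _ iota iota_inj d (malg_freeAlg k d) (malg_freeAlg K d) chark0 f g a).
Qed.
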